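(* Let $\kappa\in\mathbb R$, $\lambda>0$ and $S=\sqrt\lambda+G$ with $G\sim N(0,1)$. There exists $\alpha_0=\alpha_0(\lambda,\kappa_+)>0$ such that for all $0<\alpha<\alpha_0$ the saddle point problem $\sup_{x\in(-1,1)}\inf_{q\in[0,1)}\Phi(x,q)$ is uniquely achieved, at a pair $(x_\star,q_\star)$ which solves the system of equations $$\frac{x}{\sqrt{1-x^2}}=\alpha\sqrt{\lambda(1-q)}\;\mathbb E\Big[\mathcal A\Big(\frac{\kappa-xS-\sqrt{(1-x^2)q}\,Z}{\sqrt{(1-x^2)(1-q)}}\Big)\Big],$$ $$\frac q{1-q}=\alpha\;\mathbb E\Big[\mathcal A\Big(\frac{\kappa-xS-\sqrt{(1-x^2)q}\,Z}{\sqrt{(1-x^2)(1-q)}}\Big)^2\Big],$$ where $Z\sim N(0,1)$ is independent of $S$.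
   Context: $\kappa_+=\max\{\kappa,0\}$. $\mathcal N(x)=\int_x^\infty e^{-z^2/2}dz/\sqrt{2\pi}$ and $\mathcal A(x)=-\mathcal N'(x)/\mathcal N(x)=\frac1{\sqrt{2\pi}}e^{-x^2/2}/\mathcal N(x)$. For $(x,q)\in(-1,1)\times[0,1)$ and $Z\sim N(0,1)$ independent of $S$, $$\Phi(x,q)=\alpha\,\mathbb E\log\mathcal N\Big(\frac{\kappa-xS-\sqrt{(1-x^2)q}\,Z}{\sqrt{(1-x^2)(1-q)}}\Big)+\frac12\frac q{1-q}+\frac12\log\big((1-x^2)(1-q)\big).$$ The saddle point problem is said to be uniquely achieved at $(x_\star,q_\star)$ if there is a unique $x_\star\in[0,1)$ achieving $\sup_{x\in(-1,1)}\inf_{q\in[0,1)}\Phi(x,q)$, and a unique $q_\star\in[0,1)$ achieving $\inf_{q\in[0,1)}\Phi(x_\star,q)$. *)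

(* Defs.v *)
From HB Require Import structures.
From mathcomp Require Import all_boot all_order all_algebra.
From mathcomp Require Import all_classical all_reals all_analysis.

Set Implicit Arguments.
Unset Strict Implicit.
Unset Printing Implicit Defensive.

Import Order.TTheory GRing.Theory Num.Theory.
Import numFieldNormedType.Exports.

Local Open Scope classical_set_scope.
Local Open Scope ring_scope.

Definition gauss_tail (R : realType) (x : R) : R :=
  \int[lebesgue_measure]_(z in `[x, +oo[)
     (expR (- (z ^+ 2) / 2) / Num.sqrt (2 * pi)).

Definition inv_mills (R : realType) (x : R) : R :=
  - derive1 (@gauss_tail R) x / gauss_tail x.

(* The law is compared on Borel sets only: in this library measures are total
   set functions, whose values on non-measurable sets carry no information. *)
Definition std_gaussian d (T : measurableType d) (R : realType)
    (P : probability T R) (X : {RV P >-> R}) : Prop :=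
  forall A : set R, measurable A -> distribution P X A = normal_prob 0 1 A.

Definition independent d (T : measurableType d) (R : realType)
    (P : probability T R) (X Y : T -> R) : Prop :=
  forall A B : set R, measurable A -> measurable B ->
    P (X @^-1` A `&` Y @^-1` B) = (P (X @^-1` A) * P (Y @^-1` B))%E.

Section SaddlePoint.
Context d (T : measurableType d) (R : realType) (P : probability T R).
Variables (kappa alpha : R) (S Z : T -> R).

Definition normalized_margin (x q : R) (w : T) : R :=
  (kappa - x * S w - Num.sqrt ((1 - x ^+ 2) * q) * Z w)
  / Num.sqrt ((1 - x ^+ 2) * (1 - q)).

(* Extended-real valued, since an expectation is; meaningful for
   -1 < x < 1 and 0 <= q < 1. *)
Definition Phi (x q : R) : \bar R :=
  (alpha%:E * 'E_P[fun w => ln (gauss_tail (normalized_margin x q w))]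
   + (2^-1 * (q / (1 - q)) + 2^-1 * ln ((1 - x ^+ 2) * (1 - q)))%:E)%E.

Definition inf_Phi (x : R) : \bar R :=
  ereal_inf [set Phi x q | q in [set q : R | 0 <= q < 1]].

Definition sup_inf_Phi : \bar R :=
  ereal_sup [set inf_Phi x | x in [set x : R | -1 < x < 1]].

(* The supremum is over (-1, 1), whereas the uniqueness of its maximizer is
   only required within [0, 1). *)
Definition uniquely_achieved_at (xs qs : R) : Prop :=
  unique (fun x : R => 0 <= x < 1 /\ inf_Phi x = sup_inf_Phi) xs /\
  unique (fun q : R => 0 <= q < 1 /\ Phi xs q = inf_Phi xs) qs.

End SaddlePoint.

(* Main.v *)
(* Put m = ((1 - q) (1 - x ^ 2)) ^ (-1/2) = sqrt (1 + s ^ 2) and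
   c = kappa - x sqrt lambda.  By rotation invariance the argument of the Gaussian
   tail N in Phi has the law of m c - s g with g standard normal, so that Phi becomes
     D(x, s) = alpha E[ln N(m c - s g)] + ((1 + s ^ 2) (1 - x ^ 2) - 1) / 2
               - ln (1 + s ^ 2) / 2,
   which makes sense for every s >= 0, even when the corresponding q is negative.

   As ln N is concave, D(., s) + m ^ 2 x ^ 2 / 2 is concave for fixed s.  For fixed x,
   Gaussian integration by parts gives
     dD/ds = s / (1 + s ^ 2) h(x, s),
     h(x, s) = (1 + s ^ 2) (1 - x ^ 2) - 1 - alpha E[A(m c - s g) ^ 2],
   and h(x, .) is increasing when 0 <= x <= 1/2 and alpha is small.  The two equations
   of the system say m x = alpha sqrt lambda E[A(m c - s g)], which is criticality in x,
   and h(x, s) = 0.  Once they are solved by some (x, s), the point s is the minimum of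
   D(x, .), while D(., s) is strictly maximal at x.  Since moreover D(x', .) decreases
   where q < 0, inf_q Phi(x', q) <= D(x', s) < D(x, s) for every other x', and the
   solution is the unique saddle point.

   The equations are solved by two applications of the intermediate value theorem: with
   y = m x, the first one is increasing in y with slope at least 1, hence has a root
   depending continuously on s, which is plugged into the second one. *)
Require Import Defs.
From HB Require Import structures.
From mathcomp Require Import all_boot all_order all_algebra.
From mathcomp Require Import all_classical all_reals all_analysis.
From mathcomp Require Import measurable_realfun.
From mathcomp Require Import ring lra.
Import Order.TTheory GRing.Theory Num.Theory.
Import numFieldNormedType.Exports.
Local Open Scope classical_set_scope.
Local Open Scope ring_scope.

Set Implicit Arguments.
Unset Strict Implicit.
Unset Printing Implicit Defensive.

(** * The Gaussian tail and the inverse Mills ratio *)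

Section calculus.
Context {R : realType}.
Implicit Types (f g : R -> R) (x : R).

Lemma is_derive_continuous f df x : is_derive x 1 f df -> {for x, continuous f}.
Proof. by move=> fx; apply/differentiable_continuous/derivable1_diffP; case: fx. Qed.

(* The derivation rules of the library are stated for pointwise operations on
   functions; for the abstractions used below they need to be restated in order to
   compose by unification. *)
Lemma is_deriveMf f g x df dg : is_derive x 1 f df -> is_derive x 1 g dg ->
  is_derive x 1 (fun u => f u * g u) (df * g x + f x * dg).
Proof.
move=> hf hg; have := is_deriveM hf hg.
by move=> h; apply: (is_derive_eq h); rewrite /GRing.scale/= addrC mulrC.
Qed.

Lemma is_deriveCf (c : R) x : is_derive x 1 (fun=> c) 0.
Proof. exact: is_derive_cst. Qed.

Lemma is_deriveIf x : is_derive x 1 (fun u => u) 1.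
Proof. exact: is_derive_id. Qed.

Lemma is_deriveNf f x df : is_derive x 1 f df -> is_derive x 1 (fun u => - f u) (- df).
Proof. exact: is_deriveN. Qed.

Lemma is_deriveDf f g x df dg : is_derive x 1 f df -> is_derive x 1 g dg ->
  is_derive x 1 (fun u => f u + g u) (df + dg).
Proof. exact: is_deriveD. Qed.

Lemma is_deriveBf f g x df dg : is_derive x 1 f df -> is_derive x 1 g dg ->
  is_derive x 1 (fun u => f u - g u) (df - dg).
Proof. exact: is_deriveB. Qed.

Lemma is_derive_sqrf f x df : is_derive x 1 f df ->
  is_derive x 1 (fun u => f u ^+ 2) (2 * f x * df).
Proof. by move=> h; apply: (is_derive_eq (is_deriveMf h h)); ring. Qed.

Lemma is_deriveVf f x df : f x != 0 -> is_derive x 1 f df ->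
  is_derive x 1 (fun u => (f u)^-1) (- df / f x ^+ 2).
Proof.
move=> fx0 hf; have h := is_deriveV fx0 hf.
by apply: (is_derive_eq h); rewrite /GRing.scale/= mulrC mulrN mulNr.
Qed.

Lemma is_derive1_compf f g x df dg : is_derive (g x) 1 f df ->
  is_derive x 1 g dg -> is_derive x 1 (fun u => f (g u)) (df * dg).
Proof. by move=> hf hg; exact: (is_derive1_comp hf hg). Qed.

Lemma is_derive_MVT f (f' : R -> R) x y : x <= y ->
  (forall z, x <= z <= y -> is_derive z 1 f (f' z)) ->
  exists2 c, x <= c <= y & f y - f x = f' c * (y - x).
Proof.
move=> xy df.
have [||c] := @MVT_segment R f f' x y xy.
- by move=> z; rewrite in_itv/= => /andP[xz zy]; apply: df; rewrite !ltW.
- apply: derivable_within_continuous => z; rewrite in_itv/= => zxy.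
  by have [] := df _ zxy.
- by rewrite in_itv/= => cxy fE; exists c.
Qed.

Lemma is_derive_MVT_lt f (f' : R -> R) x y : x < y ->
  (forall z, x <= z <= y -> is_derive z 1 f (f' z)) ->
  exists2 c, x < c < y & f y - f x = f' c * (y - x).
Proof.
move=> xy df.
have [||c] := @MVT R f f' x y xy.
- by move=> z; rewrite in_itv/= => /andP[xz zy]; apply: df; rewrite !ltW.
- apply: derivable_within_continuous => z; rewrite in_itv/= => zxy.
  by have [] := df _ zxy.
- by rewrite in_itv/= => cxy fE; exists c.
Qed.

Lemma is_derive_nincr f (f' : R -> R) x y : x <= y ->
  (forall z, x <= z <= y -> is_derive z 1 f (f' z)) ->
  (forall z, x <= z <= y -> f' z <= 0) -> f y <= f x.
Proof.
move=> xy df f'0; have [c cxy fE] := is_derive_MVT xy df.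
by rewrite -subr_le0 fE mulr_le0_ge0 ?subr_ge0 ?f'0.
Qed.

Lemma is_derive_ndecr f (f' : R -> R) x y : x <= y ->
  (forall z, x <= z <= y -> is_derive z 1 f (f' z)) ->
  (forall z, x <= z <= y -> 0 <= f' z) -> f x <= f y.
Proof.
move=> xy df f'0; have [c cxy fE] := is_derive_MVT xy df.
by rewrite -subr_ge0 fE mulr_ge0 ?subr_ge0 ?f'0.
Qed.

(** A nonincreasing function stays above its limit at infinity. The bounds on the Gaussian tail
    below follow this scheme: differentiate the difference of the two sides and check that it
    vanishes at infinity. *)
Lemma is_derive_le0_cvg0 f (f' : R -> R) x :
  (forall z, x <= z -> is_derive z 1 f (f' z)) ->
  (forall z, x <= z -> f' z <= 0) ->
  f z @[z --> +oo] --> (0 : R) -> 0 <= f x.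
Proof.
move=> df f'0 f0; have -> : 0 = lim (f y @[y --> +oo]) by apply/esym/cvg_lim.
apply: limr_le; first by apply/cvg_ex; exists 0.
near=> y; apply: (@is_derive_nincr f f').
- by near: y; apply: nbhs_pinfty_ge; rewrite num_real.
- by move=> z /andP[xz _]; exact: df.
- by move=> z /andP[xz _]; exact: f'0.
Unshelve. all: by end_near. Qed.

End calculus.

(** * Gaussian density, Mills-type bounds on the tail, log-concavity of the tail *)

Section std_normal.
Context {R : realType}.
Notation mu := (@lebesgue_measure R).
Implicit Types x u : R.

Definition phi x : R := expR (- (x ^+ 2) / 2) / Num.sqrt (2 * pi).

Lemma normal_pdf01 : normal_pdf 0 1 = phi.
Proof.
apply/funext => x; rewrite normal_pdfE ?oner_eq0// /phi /normal_peak /normal_fun.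
by rewrite mulrC subr0 expr1n mul1r mulr_natl -[_ *+ 2]/(2%:R).
Qed.

Lemma sqrt2pi_gt0 : 0 < Num.sqrt (2 * pi : R).
Proof. by rewrite sqrtr_gt0 mulr_gt0// pi_gt0. Qed.

Lemma phi_gt0 x : 0 < phi x.
Proof. by rewrite divr_gt0 ?expR_gt0 ?sqrt2pi_gt0. Qed.

Lemma phiN x : phi (- x) = phi x.
Proof. by rewrite /phi sqrrN. Qed.

Lemma is_derive_phi x : is_derive x 1 phi (- x * phi x).
Proof.
rewrite /phi.
have h : is_derive x 1 (fun y : R => - (y ^+ 2) / 2) (- x).
  apply: (is_derive_eq (is_deriveMf
    (is_deriveNf (is_derive_sqrf (is_deriveIf x))) (is_deriveCf 2^-1 x))).
  by field.
apply: (is_derive_eq (is_deriveMf (is_derive1_compf (is_derive_expR _) h) (is_deriveCf _ x))).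
by rewrite mulr0 addr0 mulrA [X in X * _]mulrC.
Qed.

Lemma continuous_phi : continuous (phi : R -> R).
Proof. by move=> x; exact: (is_derive_continuous (is_derive_phi x)). Qed.

Lemma integrable_phi : mu.-integrable setT (EFin \o phi).
Proof.
have := @integrable_normal_pdf R 0 1.
by apply: eq_integrable => // x _; rewrite normal_pdf01.
Qed.

Lemma integral_phi : \int[mu]_x phi x = 1.
Proof.
rewrite /Rintegral -normal_pdf01.
by have := @integral_normal_pdf R 0 1 => ->.
Qed.

Lemma measurable_phi : measurable_fun setT (phi : R -> R).
Proof. exact: continuous_measurable_fun continuous_phi. Qed.

Local Notation N := (@gauss_tail R).

(** The tail becomes 1 minus a primitive with varying upper endpoint, the form to which the
    fundamental theorem of calculus is applied next. *)
Lemma gauss_tailE x : N x = 1 - \int[mu]_(z in `]-oo, x]) phi z.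
Proof.
have iD (D : set R) : measurable D -> mu.-integrable D (EFin \o phi).
  by move=> mD; apply: (integrableS measurableT) => //; exact: integrable_phi.
rewrite -[X in X - _]integral_phi.
have -> : [set: R] = `]-oo, x] `|` `]x, +oo[ by rewrite -(setCitvl (BRight x)) setUv.
rewrite Rintegral_setU//; last 2 first.
- by rewrite -(setCitvl (BRight x)) setUv; exact: integrable_phi.
- by rewrite -(setCitvl (BRight x)); apply/disj_setPS; rewrite setICr.
rewrite addrC addKr /gauss_tail Rintegral_itv_obnd_cbnd//.
exact: iD.
Qed.

Lemma is_derive_tail x : is_derive x 1 N (- phi x).
Proof.
have [] := @continuous_FTC1 R phi -oo%O x (x + 1).
- by rewrite ltrDl.
- by apply: (integrableS measurableT) => //; exact: integrable_phi.
- by rewrite ltNyr.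
- exact: continuous_phi.
set F := fun x0 => _ => dF F'.
have h : is_derive x 1 F (phi x).
  by apply: DeriveDef; [exact: dF|rewrite -derive1E; exact: F'].
have -> : N = fun y => cst 1 y - F y by apply/funext => y; rewrite gauss_tailE.
apply: (is_derive_eq (is_deriveBf (is_deriveCf 1 x) h)).
by rewrite sub0r.
Qed.


(** The identity as a random variable under the normal law: its cumulative distribution function is
    [1 - N], whence the limit of [N] at infinity. *)
Let idR : measurableTypeR R -> R := idfun.

HB.instance Definition _ :=
  @isMeasurableFun.Build _ _ _ _ idR (@measurable_id _ _ setT).

Lemma cvg_tail0 : N x @[x --> +oo] --> (0 : R).
Proof.
pose X : {RV (normal_prob 0 1 : probability _ R) >-> R} := idR.
have /fine_cvgP[_ h] := cvg_cdfy1 X.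
rewrite -[X in _ --> X](subrr (1 : R)).
rewrite (_ : (fun x => N x) = fun x => 1 - (fine \o cdf X) x).
  by apply: cvgB; [exact: cvg_cst|exact: h].
apply/funext => x; rewrite gauss_tailE /cdf /distribution /pushforward/= /normal_prob.
by rewrite /Rintegral normal_pdf01.
Qed.

Lemma cvg_inv0 (c : R) : c / x @[x --> +oo] --> (0 : R).
Proof.
rewrite -[X in _ --> X](mulr0 c); apply: cvgMl_tmp.
apply/gtr0_cvgV0; last exact: cvg_id.
by apply: nbhs_pinfty_gt; rewrite num_real.
Qed.

(** Follows from [1 + t <= expR t] at [t = x ^ 2 / 2]. *)
Lemma phi_mulid_le x : 0 < x -> x * phi x <= (2 / Num.sqrt (2 * pi)) / x.
Proof.
move=> x0; rewrite /phi mulrA [leRHS]mulrAC ler_pM2r ?invr_gt0 ?sqrt2pi_gt0//.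
rewrite ler_pdivlMr// mulrAC -expr2 mulNr expRN ler_pdivrMr ?expR_gt0//.
have := expR_ge1Dx (x ^+ 2 / 2).
nra.
Qed.

Lemma cvg_idphi0 : x * phi x @[x --> +oo] --> (0 : R).
Proof.
apply: (@squeeze_cvgr _ _ _ _ (fun=> 0) (fun x => (2 / Num.sqrt (2 * pi)) / x)).
- near=> x; have x0 : 0 < x by near: x; apply: nbhs_pinfty_gt; rewrite num_real.
  by rewrite phi_mulid_le// mulr_ge0 ?(ltW x0)// ltW// phi_gt0.
- exact: cvg_cst.
- exact: cvg_inv0.
Unshelve. all: by end_near. Qed.

Lemma cvg_phi0 : phi x @[x --> +oo] --> (0 : R).
Proof.
apply: (@squeeze_cvgr _ _ _ _ (fun=> 0) (fun x => x * phi x)).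
- near=> x; have x1 : 1 <= x by near: x; apply: nbhs_pinfty_ge; rewrite num_real.
  by rewrite (ltW (phi_gt0 _)) ler_peMl// ltW// phi_gt0.
- exact: cvg_cst.
- exact: cvg_idphi0.
Unshelve. all: by end_near. Qed.

(** The difference of the two sides has derivative [-2 phi y / (1 + y ^ 2) ^ 2] and vanishes at
    infinity. *)
Lemma gauss_tail_lower x : x * phi x / (1 + x ^+ 2) <= N x.
Proof.
rewrite -subr_ge0.
apply: (@is_derive_le0_cvg0 _ (fun y => N y - y * phi y / (1 + y ^+ 2))
  (fun y => - (2 * phi y / (1 + y ^+ 2) ^+ 2))).
- move=> y _.
  have y0 : 1 + y ^+ 2 != 0 by rewrite gt_eqF// ltr_pwDl// sqr_ge0.
  have dV := is_deriveVf (f := fun z => 1 + z ^+ 2) y0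
     (is_deriveDf (is_deriveCf 1 y) (is_derive_sqrf (is_deriveIf y))).
  apply: (is_derive_eq (is_deriveBf (is_derive_tail y) (is_deriveMf
    (is_deriveMf (is_deriveIf y) (is_derive_phi y)) dV))).
  by field.
- by move=> y _; rewrite oppr_le0 divr_ge0 ?sqr_ge0// mulr_ge0// ltW// phi_gt0.
- rewrite -[X in _ --> X](subr0 0); apply: cvgB; first exact: cvg_tail0.
  apply: (@squeeze_cvgr _ _ _ _ (fun=> 0) (fun x => x * phi x)).
  + near=> y; have y0 : 0 < y by near: y; apply: nbhs_pinfty_gt; rewrite num_real.
    have yp : 0 <= y * phi y by rewrite mulr_ge0 ?(ltW y0)// ltW// phi_gt0.
    rewrite divr_ge0//= ?addr_ge0 ?sqr_ge0//.
    by rewrite ler_pdivrMr ?ler_peMr// ?ltr_pwDl ?lerDl ?sqr_ge0.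
  + exact: cvg_cst.
  + exact: cvg_idphi0.
Unshelve. all: by end_near. Qed.

Lemma gauss_tail_nincr : {homo N : x y /~ x <= y}.
Proof.
move=> y x xy; apply: (@is_derive_nincr _ N (fun z => - phi z)) => //.
- by move=> z _; exact: is_derive_tail.
- by move=> z _; rewrite oppr_le0 ltW// phi_gt0.
Qed.

Lemma gauss_tail_gt0 x : 0 < N x.
Proof.
(* The lower bound is positive only at positive arguments, so [x] is first raised to at least 1,
   which can only decrease the tail. *)
apply: (@lt_le_trans _ _ (N (Num.max x 1))); last by apply: gauss_tail_nincr; rewrite le_max lexx.
have x1 : 1 <= Num.max x 1 by rewrite le_max lexx orbT.
apply: lt_le_trans (gauss_tail_lower _).
have x0 : 0 < Num.max x 1 by rewrite (lt_le_trans _ x1).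
by apply: divr_gt0; [exact: mulr_gt0 (phi_gt0 _)|rewrite ltr_pwDl ?sqr_ge0].
Qed.

Lemma gauss_tail_le1 x : N x <= 1.
Proof.
rewrite gauss_tailE lerBlDr lerDl Rintegral_ge0// => y _.
by rewrite ltW// phi_gt0.
Qed.

(** For [x > 0], the function [phi y / y - N y] has derivative [- phi y / y ^ 2] and vanishes at
    infinity; for [x <= 0] the left-hand side is nonpositive. *)
Lemma gauss_tail_upper x : x * N x <= phi x.
Proof.
have [x0|x0] := leP x 0.
  by rewrite (le_trans _ (ltW (phi_gt0 x)))// mulr_le0_ge0// ltW// gauss_tail_gt0.
rewrite mulrC -ler_pdivlMr// -subr_ge0.
apply: (@is_derive_le0_cvg0 _ (fun y => phi y / y - N y)
  (fun y => - (phi y / y ^+ 2))).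
- move=> y xy; have y0 : y != 0 by rewrite gt_eqF// (lt_le_trans x0).
  apply: (is_derive_eq (is_deriveBf (is_deriveMf (is_derive_phi y)
    (is_deriveVf y0 (is_deriveIf y))) (is_derive_tail y))).
  by field.
- by move=> y _; rewrite oppr_le0 divr_ge0 ?sqr_ge0// ltW// phi_gt0.
- rewrite -[X in _ --> X](subr0 0); apply: cvgB; last exact: cvg_tail0.
  apply: (@squeeze_cvgr _ _ _ _ (fun=> 0) phi).
  + near=> y; have y0 : 1 <= y by near: y; apply: nbhs_pinfty_ge; rewrite num_real.
    have y1 : 0 < y by rewrite (lt_le_trans _ y0).
    rewrite divr_ge0 ?(ltW (phi_gt0 _)) ?(ltW y1)//=.
    by rewrite ler_pdivrMr// ler_peMr// ltW// phi_gt0.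
  + exact: cvg_cst.
  + exact: cvg_phi0.
Unshelve. all: by end_near. Qed.

(* Nonnegativity of the variance of a Gaussian conditioned to exceed [x],
   multiplied by [N x ^+ 2]. *)
Lemma gauss_tail_variance x : 0 <= N x ^+ 2 + x * phi x * N x - phi x ^+ 2.
Proof.
(* The derivative is [- phi y * (1 + y ^ 2)] times the gap in [gauss_tail_lower], hence
   nonpositive. *)
apply: (@is_derive_le0_cvg0 _ (fun y => N y ^+ 2 + y * phi y * N y - phi y ^+ 2)
  (fun y => - (phi y * (1 + y ^+ 2) * (N y - y * phi y / (1 + y ^+ 2))))).
- move=> y _; have y0 : 1 + y ^+ 2 != 0 by rewrite gt_eqF// ltr_pwDl// sqr_ge0.
  apply: (is_derive_eq (is_deriveBf (is_deriveDf (is_derive_sqrf (is_derive_tail y))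
    (is_deriveMf (is_deriveMf (is_deriveIf y) (is_derive_phi y)) (is_derive_tail y)))
    (is_derive_sqrf (is_derive_phi y)))).
  by field.
- move=> y _; rewrite oppr_le0 mulr_ge0 ?subr_ge0 ?gauss_tail_lower//.
  by rewrite mulr_ge0 ?addr_ge0 ?sqr_ge0// ltW// phi_gt0.
- have -> : (0 : R) = 0 * 0 + 0 * 0 - 0 * 0 by rewrite mulr0 addr0 subr0.
  apply: cvgB; last by apply: cvgM; exact: cvg_phi0.
  apply: cvgD; first by apply: cvgM; exact: cvg_tail0.
  by apply: cvgM; [exact: cvg_idphi0|exact: cvg_tail0].
Qed.

Local Notation A := (@inv_mills R).

Lemma inv_millsE x : A x = phi x / N x.
Proof.
rewrite /inv_mills derive1E.
by have [_ ->] := is_derive_tail x; rewrite opprK.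
Qed.

Lemma inv_mills_gt0 x : 0 < A x.
Proof. by rewrite inv_millsE divr_gt0 ?phi_gt0 ?gauss_tail_gt0. Qed.

Lemma inv_mills_ge x : x <= A x.
Proof. by rewrite inv_millsE ler_pdivlMr ?gauss_tail_gt0 ?gauss_tail_upper. Qed.

Lemma is_derive_mills x : is_derive x 1 A (A x * (A x - x)).
Proof.
have -> : A = fun y => phi y / N y by apply/funext => y; rewrite inv_millsE.
have N0 : N x != 0 by rewrite gt_eqF// gauss_tail_gt0.
apply: (is_derive_eq (is_deriveMf (is_derive_phi x) (is_deriveVf N0 (is_derive_tail x)))).
by field.
Qed.

Lemma mills_deriv_ge0 x : 0 <= A x * (A x - x).
Proof. by rewrite mulr_ge0 ?subr_ge0 ?inv_mills_ge ?(ltW (inv_mills_gt0 _)). Qed.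

(** One minus the derivative of [A] is the variance of a Gaussian conditioned to exceed [x]. *)
Lemma mills_deriv_le1 x : A x * (A x - x) <= 1.
Proof.
rewrite -subr_ge0 inv_millsE.
have N0 := gauss_tail_gt0 x.
have -> : 1 - phi x / N x * (phi x / N x - x) =
  (N x ^+ 2 + x * phi x * N x - phi x ^+ 2) / N x ^+ 2 by field; rewrite gt_eqF.
by rewrite divr_ge0 ?gauss_tail_variance ?sqr_ge0.
Qed.

Lemma inv_mills_ndecr : {homo A : x y / x <= y}.
Proof.
move=> x y xy.
exact: (is_derive_ndecr xy (fun z _ => is_derive_mills z) (fun z _ => mills_deriv_ge0 z)).
Qed.

(** [A] is nondecreasing with slope at most 1; the mean value theorem is applied on [[0, x]] when
    [x > 0]. *)
Lemma inv_mills_le x : A x <= A 0 + Num.max x 0.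
Proof.
have [x0|x0] := leP x 0; first by rewrite addr0 inv_mills_ndecr.
have [z _|c _ E] := @is_derive_MVT R A (fun z => A z * (A z - z)) 0 x (ltW x0).
  exact: is_derive_mills.
rewrite -lerBlDl E subr0 ler_piMl ?(ltW x0)//; exact: mills_deriv_le1.
Qed.

Lemma is_derive_lntail x : is_derive x 1 (fun y => ln (N y)) (- A x).
Proof.
apply: (is_derive_eq (is_derive1_compf (is_derive1_ln (gauss_tail_gt0 x)) (is_derive_tail x))).
by rewrite inv_millsE mulrN mulrC.
Qed.

Lemma lntail_le0 x : ln (N x) <= 0.
Proof. by rewrite ln_le0// gauss_tail_le1. Qed.

(** This is concavity of [ln N]: its derivative [- A] is nonincreasing. *)
Lemma lntail_tangent x y : ln (N y) <= ln (N x) - A x * (y - x).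
Proof.
rewrite -subr_ge0.
have [xy|/ltW yx] := leP x y.
- have [z _|c /andP[xc _] E] := @is_derive_MVT R (fun y => ln (N y)) (fun z => - A z) x y xy.
    exact: is_derive_lntail.
  have -> : ln (N x) - A x * (y - x) - ln (N y) = (A c - A x) * (y - x).
    by move/eqP: E; rewrite subr_eq => /eqP ->; ring.
  by rewrite mulr_ge0 ?subr_ge0// inv_mills_ndecr.
- have [z _|c /andP[_ cx] E] := @is_derive_MVT R (fun y => ln (N y)) (fun z => - A z) y x yx.
    exact: is_derive_lntail.
  have -> : ln (N x) - A x * (y - x) - ln (N y) = (A x - A c) * (x - y).
    by move/eqP: E; rewrite subr_eq => /eqP ->; ring.
  by rewrite mulr_ge0 ?subr_ge0// inv_mills_ndecr.
Qed.

Lemma continuous_mills : continuous A.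
Proof. by move=> x; exact: (is_derive_continuous (is_derive_mills x)). Qed.

End std_normal.

(** * Gaussian expectations *)

Section gauss_expectation.
Context {R : realType}.
Notation mu := (@lebesgue_measure R).
Notation P01 := (@normal_prob R 0 1).
Implicit Types (f g h : R -> R) (x u : R).

(** Expectations under the normal law turn into Lebesgue integrals through a Radon-Nikodym
    derivative, which is identified here with the explicit density. *)
Lemma ae_eq_normal_density : ae_eq mu setT
  (Radon_Nikodym_SigmaFinite.f P01 mu) (fun x => (phi x)%:E).
Proof.
have dom := @normal_prob_dominates R 0 1.
apply: integral_ae_eq => //.
- exact: Radon_Nikodym_SigmaFinite.f_integrable.
- by apply/measurable_EFinP; exact: measurable_phi.
- move=> E _ mE; rewrite -Radon_Nikodym_SigmaFinite.f_integral//.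
  by rewrite -[LHS]/(\int[mu]_(x in E) (normal_pdf 0 1 x)%:E)%E normal_pdf01.
Qed.

Lemma ge0_integral_normal (f : R -> \bar R) : measurable_fun setT f ->
  (forall x, 0 <= f x)%E ->
  (\int[P01]_x f x = \int[mu]_x (f x * (phi x)%:E))%E.
Proof.
move=> mf f0; have dom := @normal_prob_dominates R 0 1.
rewrite -(Radon_Nikodym_SigmaFinite.change_of_variables dom)//.
apply: ae_eq_integral => //.
- apply: emeasurable_funM => //.
  exact: measurable_int (Radon_Nikodym_SigmaFinite.f_integrable dom).
- by apply: emeasurable_funM => //; apply/measurable_EFinP; exact: measurable_phi.
- by apply: ae_eqe_mul2l; exact: ae_eq_normal_density.
Qed.

Lemma integral_normal (f : R -> \bar R) : P01.-integrable setT f ->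
  (\int[P01]_x f x = \int[mu]_x (f x * (phi x)%:E))%E.
Proof.
move=> intf; have dom := @normal_prob_dominates R 0 1.
have mf : measurable_fun setT f := measurable_int _ intf.
rewrite -(Radon_Nikodym_change_of_variables dom)//.
apply: ae_eq_integral => //.
- by apply: emeasurable_funM.
- by apply: emeasurable_funM => //; apply/measurable_EFinP; exact: measurable_phi.
- apply: ae_eqe_mul2l.
  apply: ae_eq_trans; last exact: ae_eq_normal_density.
  exact/ae_eq_sym/ae_eq_Radon_Nikodym_SigmaFinite.
Qed.

Definition gE f : R := \int[P01]_x f x.

(** Two classes that settle all integrability questions: a product of two functions of linear growth
    has quadratic growth, and quadratic growth implies integrability under the Gaussian law. *)
Definition lin_growth f := continuous f /\ exists C : R, forall u, `|f u| <= C * (1 + `|u|).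
Definition quad_growth f := continuous f /\ exists C : R, forall u, `|f u| <= C * (1 + u ^+ 2).

Lemma lin_growth_ge0 f (C : R) : (forall u, `|f u| <= C * (1 + `|u|)) -> 0 <= C.
Proof. by move=> /(_ 0); rewrite normr0 addr0 mulr1; exact: le_trans. Qed.

Lemma quad_growth_ge0 f (C : R) : (forall u, `|f u| <= C * (1 + u ^+ 2)) -> 0 <= C.
Proof. by move=> /(_ 0); rewrite expr0n addr0 mulr1; exact: le_trans. Qed.

(** Since [(1 + u ^ 2) exp (- u ^ 2 / 2) <= 4 exp (- u ^ 2 / 4)], a multiple of the centred normal
    density of variance 2 dominates; [K] is 4 times the ratio of the normalizing constants. *)
Lemma integrable_mu_quad : mu.-integrable setT (fun u => ((1 + u ^+ 2) * phi u)%:E).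
Proof.
pose K : R := 4 * (Num.sqrt (2 * pi))^-1 / normal_peak (Num.sqrt 2).
have s2 : Num.sqrt 2 != 0 :> R by rewrite gt_eqF// sqrtr_gt0.
apply: (@le_integrable _ _ _ mu _ _ _ (fun u => (K * normal_pdf 0 (Num.sqrt 2) u)%:E)) => //.
- apply/measurable_EFinP; apply: measurable_funM; last exact: measurable_phi.
  by apply: measurable_funD => //; exact: measurable_funX.
- move=> u _; rewrite lee_fin.
  have u1 : 0 <= 1 + u ^+ 2 by rewrite addr_ge0 ?sqr_ge0.
  rewrite ger0_norm ?mulr_ge0 ?(ltW (phi_gt0 _))//.
  rewrite ger0_norm; last first.
    by rewrite mulr_ge0 ?normal_pdf_ge0// !mulr_ge0 ?invr_ge0 ?sqrtr_ge0 ?normal_peak_ge0.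
  rewrite normal_pdfE// /K /phi /normal_fun subr0 sqr_sqrtr//.
  rewrite [leRHS]mulrA divfK ?gt_eqF ?normal_peak_gt0// mulrA mulrC.
  rewrite [4 / _]mulrC -[leRHS]mulrA ler_pM2l ?invr_gt0 ?sqrt2pi_gt0//.
  have -> : - u ^+ 2 / 2 = - (u ^+ 2 / 4) - u ^+ 2 / 4 by field.
  have -> : 2 *+ 2 = 4 :> R by rewrite -mulr_natr -natrM.
  rewrite [X in 4 * expR X]mulNr.
  rewrite expRD mulrA ler_pM2r ?expR_gt0// expRN ler_pdivrMr ?expR_gt0//.
  have := expR_ge1Dx (u ^+ 2 / 4); lra.
- under eq_fun do rewrite EFinM.
  by apply: integrableZl => //; exact: integrable_normal_pdf.
Qed.

Lemma integrable_quad1 : P01.-integrable setT (fun u => (1 + u ^+ 2)%:E).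
Proof.
have m1 : measurable_fun setT (fun u : R => (1 + u ^+ 2)%:E).
  by apply/measurable_EFinP; apply: measurable_funD => //; exact: measurable_funX.
apply/integrableP; split => //.
rewrite ge0_integral_normal//; last exact: measurableT_comp.
have /integrableP[_] := integrable_mu_quad; apply: le_lt_trans.
rewrite le_eqVlt; apply/orP; left; apply/eqP; apply: eq_integral => u _.
by rewrite /= -EFinM normrM (ger0_norm (ltW (phi_gt0 u))).
Qed.

Lemma quad_integrable f : quad_growth f -> P01.-integrable setT (EFin \o f).
Proof.
move=> [cf [C fC]].
have mf := continuous_measurable_fun cf.
apply: (@le_integrable _ _ _ P01 _ _ _ (fun u => (C%:E * (1 + u ^+ 2)%:E))%E) => //.
- exact/measurable_EFinP.
- move=> u _; rewrite -EFinM lee_fin (le_trans (fC u))// ler_norm//.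
- by apply: integrableZl => //; exact: integrable_quad1.
Qed.

Lemma lin_quad f : lin_growth f -> quad_growth f.
Proof.
move=> [cf [C fC]]; split => //; exists (2 * C) => u.
have C0 := lin_growth_ge0 fC.
rewrite (le_trans (fC u))// [2 * C]mulrC -mulrA ler_wpM2l//.
by rewrite -(real_normK (num_real u)); have := sqr_ge0 (`|u| - 1); nra.
Qed.

Lemma linM f g : lin_growth f -> lin_growth g -> quad_growth (fun u => f u * g u).
Proof.
move=> [cf [C fC]] [cg [D gD]]; split; first by move=> x; apply: cvgM; [exact: cf|exact: cg].
have C0 := lin_growth_ge0 fC.
have D0 := lin_growth_ge0 gD.
exists (2 * (C * D)) => u; rewrite normrM.
apply: (le_trans (ler_pM _ _ (fC u) (gD u))) => //.
rewrite mulrACA [2 * _]mulrC -[leRHS]mulrA; apply: ler_wpM2l; first exact: mulr_ge0.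
by rewrite -(real_normK (num_real u)); have := sqr_ge0 (`|u| - 1); nra.
Qed.

Lemma quadD f g : quad_growth f -> quad_growth g -> quad_growth (fun u => f u + g u).
Proof.
move=> [cf [C fC]] [cg [D gD]]; split; first by move=> x; apply: cvgD; [exact: cf|exact: cg].
by exists (C + D) => u; rewrite (le_trans (ler_normD _ _))// mulrDl lerD.
Qed.

Lemma quadZ c f : quad_growth f -> quad_growth (fun u => c * f u).
Proof.
move=> [cf [C fC]]; split; first by move=> x; apply: cvgM; [exact: cvg_cst|exact: cf].
by exists (`|c| * C) => u; rewrite normrM -mulrA ler_wpM2l.
Qed.

Lemma quadC c : quad_growth (fun=> c).
Proof.
split; first exact: cst_continuous.
by exists `|c| => u; rewrite ler_peMr// lerDl sqr_ge0.
Qed.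

Lemma lin_affine a b : lin_growth (fun u => a + b * u).
Proof.
split; first by move=> x; apply: cvgD; [exact: cvg_cst|apply: cvgM; [exact: cvg_cst|exact: cvg_id]].
exists (`|a| + `|b|) => u; rewrite (le_trans (ler_normD _ _))// normrM.
by have := normr_ge0 a; have := normr_ge0 b; have := normr_ge0 u; nra.
Qed.

Lemma lin_id : lin_growth (fun u : R => u).
Proof.
rewrite (_ : (fun u : R => u) = fun u => 0 + 1 * u); first exact: lin_affine.
by apply/funext => u; rewrite add0r mul1r.
Qed.

(** The constant is explicit so that it stays bounded when [a] and [b] range over bounded sets, as
    domination in [gE_comp_continuous] requires. *)
Lemma quad_affine_bound f C : (forall u, `|f u| <= C * (1 + u ^+ 2)) ->
  forall a b u, `|f (a + b * u)| <= C * (1 + 2 * a ^+ 2 + 2 * b ^+ 2) * (1 + u ^+ 2).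
Proof.
move=> fC a b u.
have C0 := quad_growth_ge0 fC.
rewrite (le_trans (fC _))// -mulrA ler_wpM2l//.
have := sqr_ge0 (a - b * u); have := sqr_ge0 (a * u); have := sqr_ge0 b; have := sqr_ge0 u.
nra.
Qed.

Lemma quad_comp_affine f a b : quad_growth f -> quad_growth (fun u => f (a + b * u)).
Proof.
move=> [cf [C fC]]; split.
  move=> x; apply: (continuous_comp (f := fun u => a + b * u)); last exact: cf.
  by have [+ _] := lin_affine a b; exact.
by eexists => u; exact: (quad_affine_bound fC).
Qed.

Lemma lin_comp_affine f a b : lin_growth f -> lin_growth (fun u => f (a + b * u)).
Proof.
move=> [cf [C fC]]; split.
  move=> x; apply: (continuous_comp (f := fun u => a + b * u)); last exact: cf.
  by have [+ _] := lin_affine a b; exact.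
have C0 := lin_growth_ge0 fC.
exists (C * (1 + `|a| + `|b|)) => u; rewrite (le_trans (fC _))// -mulrA ler_wpM2l//.
rewrite -addrA (le_trans (lerD (lexx 1) (ler_normD _ _)))// normrM.
by have := normr_ge0 a; have := normr_ge0 b; have := normr_ge0 u; nra.
Qed.

Lemma gE_D f g : quad_growth f -> quad_growth g -> gE (fun u => f u + g u) = gE f + gE g.
Proof. by move=> qf qg; rewrite /gE RintegralD//; exact: quad_integrable. Qed.

Lemma gE_Z c f : quad_growth f -> gE (fun u => c * f u) = c * gE f.
Proof. by move=> qf; rewrite /gE RintegralZl//; exact: quad_integrable. Qed.

Lemma gE_C c : gE (fun=> c) = c.
Proof.
rewrite /gE Rintegral_cst// [X in fine X](_ : _ = 1%E) ?mulr1//.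
exact: (probability_setT P01).
Qed.

Lemma gE_le f g : quad_growth f -> quad_growth g -> (forall u, f u <= g u) -> gE f <= gE g.
Proof.
move=> qf qg fg; apply: le_Rintegral => //.
- exact: quad_integrable.
- exact: quad_integrable.
Qed.

Lemma gE_ge0 f : (forall u, 0 <= f u) -> 0 <= gE f.
Proof. by move=> f0; apply: Rintegral_ge0. Qed.

End gauss_expectation.

(** * Gaussian integration by parts, and parameters under the expectation *)

Section gauss_ibp.
Context {R : realType}.
Notation mu := (@lebesgue_measure R).
Notation P01 := (@normal_prob R 0 1).
Implicit Types (f g h : R -> R) (x u : R).

Lemma gE_density f : quad_growth f -> 
  mu.-integrable setT (fun u => (f u * phi u)%:E) /\
  gE f = \int[mu]_u (f u * phi u).
Proof.
move=> qf; have [cf [C fC]] := qf; split.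
- apply: (@le_integrable _ _ _ mu _ _ _ (fun u => C%:E * ((1 + u ^+ 2) * phi u)%:E)%E) => //.
  + apply/measurable_EFinP; apply: measurable_funM; last exact: measurable_phi.
    exact: continuous_measurable_fun.
  + have bd (u : R) : `|f u * phi u| <= C * ((1 + u ^+ 2) * phi u).
      by rewrite normrM (ger0_norm (ltW (phi_gt0 u))) mulrA ler_wpM2r// ltW// phi_gt0.
    by move=> u _; rewrite -EFinM lee_fin (le_trans _ (ler_norm _)).
  + by apply: integrableZl => //; exact: integrable_mu_quad.
- rewrite /gE /Rintegral integral_normal//; exact: quad_integrable.
Qed.

Lemma cvg_Rintegral_itv (k : R -> R) : mu.-integrable setT (EFin \o k) ->
  \int[mu]_(x in `[- n%:R, n%:R]) k x @[n --> \oo] --> \int[mu]_x k x.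
Proof.
move=> ik; apply: fine_cvg.
rewrite [X in _ --> X]fineK; last exact: integrable_fin_num.
under eq_fun do rewrite integral_mkcond.
apply: (@dominated_cvg _ _ _ mu _ _
  (fun n => (fun x => (k x)%:E) \_ `[- n%:R, n%:R]) _ (fun x => `|(k x)%:E|)%E) => //.
- move=> n; apply/(measurable_restrictT _ _).1 => //.
  by apply: measurable_funTS; exact: measurable_int ik.
- move=> x _; apply: cvg_near_cst; near=> n.
  rewrite patchE mem_set//= in_itv/= -ler_norml.
  near: n; exact: nbhs_infty_ger.
- exact: integrable_abse.
- move=> n x _; rewrite patchE; case: ifPn => // _.
  by rewrite abse0.
Unshelve. all: by end_near. Qed.

(** The integrand [k x * phi x], with [k x = h' x - x * h x], is the derivative of [h * phi]. Its
    integral over [[-n, n]] is a boundary term, bounded by [B n], which tends to 0 by linear growth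
    of [h]. *)
Lemma gE_ibp h (h' : R -> R) : (forall x, is_derive x 1 h (h' x)) ->
  lin_growth h -> quad_growth h' -> gE (fun u => u * h u) = gE h'.
Proof.
move=> dh lh qh'.
have lid := @lin_id R.
have qh : quad_growth (fun u => u * h u) by exact: linM.
pose k x := h' x + (-1) * (x * h x).
have qk : quad_growth k by apply: quadD => //; exact: quadZ.
have [ik Ek] := gE_density qk.
suff : gE k = 0.
  rewrite /k gE_D//; last exact: quadZ.
  by rewrite gE_Z// mulN1r => /eqP; rewrite subr_eq0 => /eqP.
rewrite Ek.
apply: (@cvg_unique _ _ (\int[mu]_(x in `[- n%:R, n%:R]) (k x * phi x) @[n --> \oo])) => //.
  exact: (cvg_Rintegral_itv ik).
have dF x : is_derive x 1 (fun x => h x * phi x) (k x * phi x).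
  by apply: (is_derive_eq (is_deriveMf (dh x) (is_derive_phi x))); rewrite /k; ring.
have cF : continuous (fun x => h x * phi x).
  by move=> x; exact: is_derive_continuous (dF x).
have ck : continuous (fun x => k x * phi x).
  by move=> x; apply: cvgM; [have [+ _] := qk; exact|exact: continuous_phi].
have [_ [C hC]] := lh.
have C0 := lin_growth_ge0 hC.
pose B n : R := C * (phi n%:R + n%:R * phi n%:R) *+ 2.
have B0 : B n @[n --> \oo] --> (0 : R).
  rewrite -[X in _ --> X](mul0rn _ 2) -[X in X *+ 2](mulr0 C) -[X in C * X](addr0 0).
  apply: cvgMn; apply: cvgMl_tmp.
  by apply: cvgD; [have /cvg_pinftyP := @cvg_phi0 R|have /cvg_pinftyP := @cvg_idphi0 R];
    apply; exact: cvgr_idn.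
apply: (@squeeze_cvgr _ _ _ _ (fun n => - B n) B).
- near=> n; rewrite -ler_norml.
  have n0 : (0 : R) < n%:R by rewrite ltr0n; near: n; exists 1%N.
  have -> : \int[mu]_(x in `[- n%:R, n%:R]) (k x * phi x) =
     h n%:R * phi n%:R - h (- n%:R) * phi n%:R.
    rewrite /Rintegral (@continuous_FTC2 _ _ (fun x => h x * phi x)).
    + by rewrite /= phiN.
    + by rewrite -subr_gt0 opprK addr_gt0.
    + exact: continuous_subspaceT.
    + split => [x _||]; first by have [] := dF x.
      * by apply: cvg_at_right_filter; exact: cF.
      * by apply: cvg_at_left_filter; exact: cF.
    + by move=> x _; rewrite derive1E; have [_ ->] := dF x.
  rewrite -mulrBl normrM (ger0_norm (ltW (phi_gt0 _))).
  have -> : B n = (C * (1 + n%:R) + C * (1 + n%:R)) * phi n%:R.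
    by rewrite /B mulr2n; ring.
  apply: ler_wpM2r; first exact: ltW (phi_gt0 _).
  rewrite (le_trans (ler_normB _ _))// lerD//.
    by rewrite (le_trans (hC _))// ger0_norm// ltW.
  by rewrite (le_trans (hC _))// normrN ger0_norm// ltW.
- by rewrite -oppr0; apply: cvgN; exact: B0.
- exact: B0.
Unshelve. all: by end_near. Qed.


Lemma gE_continuous (F : R -> R -> R) (a u v C : R) : u < a < v ->
  (forall t, quad_growth (F t)) ->
  (forall t w : R, u < t < v -> `|F t w| <= C * (1 + w ^+ 2)) ->
  (forall w, continuous (F ^~ w)) ->
  {for a, continuous (fun t => gE (F t))}.
Proof.
move=> auv qF FC cF.
pose G (y : R) := C * (1 + y ^+ 2).
have iG : P01.-integrable setT (EFin \o G).
  rewrite /G /comp; under eq_fun do rewrite EFinM.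
  by apply: integrableZl => //; exact: integrable_quad1.
apply: (@continuity_under_integral R _ _ P01 F setT measurableT u v _ _ G iG).
- by move=> x _; exact: quad_integrable.
- by apply/aeW => y _ x _; exact: cF.
- by move=> x; rewrite /= in_itv/= => xuv; apply/aeW => y _; exact: FC.
- by rewrite inE /= in_itv.
Qed.

Lemma gE_is_derive (F F' : R -> R -> R) (a u v C : R) : u < a < v ->
  (forall t, quad_growth (F t)) ->
  (forall t w : R, is_derive t 1 (F ^~ w) (F' t w)) ->
  (forall t w : R, u < t < v -> `|F' t w| <= C * (1 + w ^+ 2)) ->
  is_derive a 1 (fun t => gE (F t)) (gE (F' a)).
Proof.
move=> auv qF dF FC.
have Ia : `]u, v[%classic a by rewrite /= in_itv.
have C0 : 0 <= C.
  by have := FC a 0 auv; rewrite expr0n addr0 mulr1; exact: le_trans.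
have dFE t w : partial1of2 F t w = F' t w.
  by rewrite /partial1of2 derive1E; have [_ ->] := dF t w.
have intf x : `]u, v[%classic x -> P01.-integrable setT (EFin \o F x).
  by move=> _; exact: quad_integrable.
have derf1 x y : `]u, v[%classic x -> setT y -> derivable (F ^~ y) x 1.
  by move=> _ _; have [] := dF x y.
pose G (y : R) := C * (1 + y ^+ 2).
have G0 y : 0 <= G y by rewrite mulr_ge0// addr_ge0 ?sqr_ge0.
have iG : P01.-integrable setT (EFin \o G).
  rewrite /G /comp; under eq_fun do rewrite EFinM.
  by apply: integrableZl => //; exact: integrable_quad1.
have Gub x y : `]u, v[%classic x -> setT y -> `|partial1of2 F x y| <= G y.
  by move=> Ix _; rewrite dFE FC//; move: Ix; rewrite /= in_itv.
apply: DeriveDef.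
  exact: (derivable_under_integral (mu := P01) measurableT Ia intf derf1 G0 iG Gub).
rewrite -derive1E.
rewrite [LHS](differentiation_under_integral (mu := P01) measurableT Ia intf derf1 G0 iG Gub).
by apply: eq_Rintegral => y _; exact: dFE.
Qed.


Lemma sqrt1D_gt0 s : 0 < Num.sqrt (1 + s ^+ 2) :> R.
Proof. by rewrite sqrtr_gt0 ltr_pwDl// sqr_ge0. Qed.

Lemma sqr_sqrt1D s : Num.sqrt (1 + s ^+ 2) ^+ 2 = 1 + s ^+ 2 :> R.
Proof. by rewrite sqr_sqrtr// addr_ge0// sqr_ge0. Qed.

Lemma is_derive_sqrt1D (s : R) : is_derive s 1 (fun s => Num.sqrt (1 + s ^+ 2))
  (s / Num.sqrt (1 + s ^+ 2)).
Proof.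
have p : 0 < 1 + s ^+ 2 by rewrite ltr_pwDl// sqr_ge0.
apply: (is_derive_eq (is_derive1_compf (g := fun s => 1 + s ^+ 2) (is_derive1_sqrt p)
  (is_deriveDf (is_deriveCf 1 s) (is_derive_sqrf (is_deriveIf s))))).
by have := sqrt1D_gt0 s; move=> h; field; rewrite gt_eqF.
Qed.

(* With [L := ln (1 + s ^+ 2)] the law of [sqrt (1 + s ^+ 2) * c - s * g] is that
   of the (mean-repelling) Ornstein-Uhlenbeck process with generator
   [f'' + u f'], up to a factor 1/2, started at [c] at time [L = 0]. *)
Lemma is_derive_gE_margin (f f' f'' : R -> R) (c s : R) :
  (forall u, is_derive u 1 f (f' u)) -> (forall u, is_derive u 1 f' (f'' u)) ->
  quad_growth f -> lin_growth f' -> quad_growth f'' ->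
  is_derive s 1 (fun s => gE (fun w => f (Num.sqrt (1 + s ^+ 2) * c - s * w)))
    (s / (1 + s ^+ 2) * gE (fun w => f'' (Num.sqrt (1 + s ^+ 2) * c - s * w)
       + (Num.sqrt (1 + s ^+ 2) * c - s * w) * f' (Num.sqrt (1 + s ^+ 2) * c - s * w))).
Proof.
move=> df df' qf lf' qf''.
have UE t w : Num.sqrt (1 + t ^+ 2) * c - t * w = Num.sqrt (1 + t ^+ 2) * c + (- t) * w.
  by rewrite mulNr.
have qfU (h : R -> R) t : quad_growth h ->
    quad_growth (fun w => h (Num.sqrt (1 + t ^+ 2) * c - t * w)).
  by move=> qh; under eq_fun do rewrite UE; exact: quad_comp_affine.
have lfU (h : R -> R) t : lin_growth h ->
    lin_growth (fun w => h (Num.sqrt (1 + t ^+ 2) * c - t * w)).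
  by move=> qh; under eq_fun do rewrite UE; exact: lin_comp_affine.
have dU (t w : R) : is_derive t 1 (fun t => Num.sqrt (1 + t ^+ 2) * c - t * w)
   (t / Num.sqrt (1 + t ^+ 2) * c - w).
  apply: (is_derive_eq (is_deriveBf (is_deriveMf (is_derive_sqrt1D t) (is_deriveCf c t))
    (is_deriveMf (is_deriveIf t) (is_deriveCf w t)))).
  by ring.
pose F (t w : R) := f (Num.sqrt (1 + t ^+ 2) * c - t * w).
pose F' (t w : R) := f' (Num.sqrt (1 + t ^+ 2) * c - t * w) * (t / Num.sqrt (1 + t ^+ 2) * c - w).
have [_ [C f'C]] := lf'.
have C0 := lin_growth_ge0 f'C.
(* For [t] within 1 of [s], the square root is at most [2 + |s|]; hence [K * (1 + |w|)] bounds both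
   1 plus the modulus of the argument of [f'] and the modulus of the derivative of that argument in
   [t]. *)
pose K : R := (3 + `|s|) * (1 + `|c|).
have FC (t w : R) : s - 1 < t < s + 1 -> `|F' t w| <= (2 * C * K ^+ 2) * (1 + w ^+ 2).
  move=> /andP[t1 t2]; rewrite /F' normrM.
  have c0 := normr_ge0 c; have s0 := normr_ge0 s; have w0 := normr_ge0 w.
  have cw0 := mulr_ge0 c0 w0; have scw0 := mulr_ge0 s0 cw0.
  have sc0 := mulr_ge0 s0 c0; have sw0 := mulr_ge0 s0 w0.
  have tle : `|t| <= 1 + `|s|.
    rewrite -[t](subrK s) (le_trans (ler_normD _ _))// lerD2r ler_norml; lra.
  have t0 := normr_ge0 t.
  have m0 := sqrt1D_gt0 t.
  have tm : `|t| <= Num.sqrt (1 + t ^+ 2).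
    by rewrite -(sqrtr_sqr t) ler_wsqrtr// lerDr.
  have mle : Num.sqrt (1 + t ^+ 2) <= 2 + `|s|.
    rewrite -[leRHS]ger0_norm ?addr_ge0// -(sqrtr_sqr) ler_wsqrtr//.
    rewrite -(real_normK (num_real t)); nra.
  have K1 : `|Num.sqrt (1 + t ^+ 2) * c - t * w| <= (2 + `|s|) * (`|c| + `|w|).
    rewrite (le_trans (ler_normB _ _))// !normrM (ger0_norm (ltW m0)) mulrDr lerD//.
      exact: ler_wpM2r.
    by apply: ler_wpM2r => //; lra.
  have K2 : `|t / Num.sqrt (1 + t ^+ 2) * c - w| <= `|c| + `|w|.
    rewrite (le_trans (ler_normB _ _))// lerD2r normrM ler_piMl// normrM normfV.
    by rewrite (ger0_norm (ltW m0)) ler_pdivrMr// mul1r.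
  apply: (@le_trans _ _ ((C * (K * (1 + `|w|))) * (K * (1 + `|w|)))).
    apply: ler_pM => //.
      rewrite (le_trans (f'C _))// ler_wpM2l// (le_trans (lerD (lexx 1) K1))//.
      rewrite /K; nra.
    rewrite (le_trans K2)// /K; nra.
  have -> : C * (K * (1 + `|w|)) * (K * (1 + `|w|)) = C * K ^+ 2 * (1 + `|w|) ^+ 2 by ring.
  have -> : 2 * C * K ^+ 2 * (1 + w ^+ 2) = C * K ^+ 2 * (2 * (1 + w ^+ 2)) by ring.
  apply: ler_wpM2l; first by rewrite mulr_ge0// sqr_ge0.
  by rewrite -(real_normK (num_real w)); have := sqr_ge0 (`|w| - 1); nra.
have sI : s - 1 < s < s + 1 by lra.
have D := @gE_is_derive F F' s (s - 1) (s + 1) _ sI (fun t => qfU f t qf)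
   (fun t w => is_derive1_compf (df _) (dU t w)) FC.
apply: (is_derive_eq D).
set m := Num.sqrt (1 + s ^+ 2).
have m0 : 0 < m := sqrt1D_gt0 s.
(* Integration by parts trades the factor [w] for [f'']. Both sides of the goal then become
   combinations of the means of [f'] and [f''], and they agree because [m ^ 2 = 1 + s ^ 2]. *)
have ibp : gE (fun w => w * f' (m * c - s * w)) = gE (fun w => (- s) * f'' (m * c - s * w)).
  apply: gE_ibp.
  - move=> w; have dw : is_derive w 1 (fun w => m * c - s * w) (- s).
      apply: (is_derive_eq (is_deriveBf (is_deriveCf (m * c) w)
        (is_deriveMf (is_deriveCf s w) (is_deriveIf w)))); by ring.
    by apply: (is_derive_eq (is_derive1_compf (df' _) dw)); rewrite mulrC.
  - exact: lfU.
  - by apply: quadZ; exact: qfU.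
have q1 := lin_quad (lfU f' s lf').
have q2 := qfU f'' s qf''.
have lid := @lin_id R.
have q3 : quad_growth (fun w => w * f' (m * c - s * w)) by apply: linM => //; exact: lfU.
rewrite gE_Z// in ibp.
have -> : gE (F' s) =
  s / m * c * gE (fun w => f' (m * c - s * w)) + s * gE (fun w => f'' (m * c - s * w)).
  have -> : F' s =
    fun w => (s / m * c) * f' (m * c - s * w) + (-1) * (w * f' (m * c - s * w)).
    by apply/funext => w; rewrite /F' -/m; ring.
  by rewrite gE_D ?gE_Z// ?ibp; [ring|exact: quadZ|exact: quadZ].
have -> : gE (fun w => f'' (m * c - s * w) + (m * c - s * w) * f' (m * c - s * w)) =
  (1 + s ^+ 2) * gE (fun w => f'' (m * c - s * w)) + m * c * gE (fun w => f' (m * c - s * w)).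
  have -> : (fun w => f'' (m * c - s * w) + (m * c - s * w) * f' (m * c - s * w)) =
    fun w => f'' (m * c - s * w) +
      ((m * c) * f' (m * c - s * w) + (- s) * (w * f' (m * c - s * w))).
    by apply/funext => w; ring.
  rewrite gE_D//; last by apply: quadD; exact: quadZ.
  rewrite gE_D; [|exact: quadZ|exact: quadZ].
  by rewrite !gE_Z// ibp; ring.
by rewrite -sqr_sqrt1D -/m; field; rewrite gt_eqF.
Qed.

End gauss_ibp.

(** * Rotation invariance *)

Section gauss_rotation.
Context {R : realType}.
Notation mu := (@lebesgue_measure R).
Notation P01 := (@normal_prob R 0 1).
Local Open Scope ereal_scope.

Lemma ge0_integral_lebesgueN (f : R -> \bar R) : measurable_fun setT f ->
  (forall x, 0 <= f x) -> \int[mu]_x f (- x)%R = \int[mu]_x f x.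
Proof.
move=> mf f0.
transitivity (\int[pushforward mu (-%R : _ -> measurableTypeR R)]_x f x).
  by rewrite ge0_integral_pushforward.
by apply: eq_measure_integral => A mA _; exact: lebesgue_measureN.
Qed.

Lemma ge0_integral_normalN (f : R -> \bar R) : measurable_fun setT f ->
  (forall x, 0 <= f x) -> \int[P01]_x f (- x)%R = \int[P01]_x f x.
Proof.
move=> mf f0; rewrite !ge0_integral_normal//; last exact: measurableT_comp.
have mfp : measurable_fun setT (fun x => f x * (phi x)%:E).
  by apply: emeasurable_funM => //; apply/measurable_EFinP; exact: measurable_phi.
have fp0 x : 0 <= f x * (phi x)%:E by rewrite mule_ge0// lee_fin ltW// phi_gt0.
apply: etrans (ge0_integral_lebesgueN mfp fp0).
by apply: eq_integral => x _; rewrite phiN.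
Qed.

Lemma ge0_integral_affine (h : R -> R) (k b : R) : (0 < b)%R -> continuous h ->
  (forall x, 0 <= h x)%R ->
  \int[mu]_x (h x)%:E = \int[mu]_x (h (k + b * x) * b)%:E.
Proof.
move=> b0 ch h0.
have dF (x : R) : is_derive x (1 : R)%R (fun x : R => k + b * x)%R b.
  apply: (is_derive_eq (is_deriveDf (is_deriveCf k x)
    (is_deriveMf (is_deriveCf b x) (is_deriveIf x)))).
  by ring.
have F'E : (fun x : R => k + b * x)%R^`()%classic = cst b.
  by apply/funext => x; rewrite derive1E; have [_ ->] := dF x.
rewrite (@increasing_ge0_integration_by_substitutionT _ (fun x => k + b * x)%R)//.
- by rewrite F'E.
- by move=> x y xy; rewrite ltrD2l ltr_pM2l.
- by rewrite F'E => x; exact: cvg_cst.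
- by rewrite F'E; exact: is_cvg_cst.
- by rewrite F'E; exact: is_cvg_cst.
- apply/cvgrNyPle => A; have : \forall x \near -oo%R, (x <= (A - k) / b)%R.
    by apply: nbhs_ninfty_le; rewrite num_real.
  by apply: filterS => x; rewrite ler_pdivlMr// mulrC lerBrDl.
- apply/cvgryPge => A; have : \forall x \near +oo%R, ((A - k) / b <= x)%R.
    by apply: nbhs_pinfty_ge; rewrite num_real.
  by apply: filterS => x; rewrite ler_pdivrMr// mulrC lerBlDl.
Qed.

Lemma continuous_comp_affine (f : R -> R) (k b : R) : continuous f ->
  continuous (fun z => f (k + b * z))%R.
Proof.
move=> cf z; apply: (continuous_comp (f := fun u => k + b * u)%R); last exact: cf.
by have [+ _] := lin_affine k b; exact.
Qed.

Lemma continuousMf (f g : R -> R) : continuous f -> continuous g ->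
  continuous (fun z => f z * g z)%R.
Proof. by move=> cf cg z; apply: cvgM; [exact: cf|exact: cg]. Qed.

(** Substitute [y = c + a g + b z] in the inner integral, exchange the integrals by Tonelli, and
    integrate out [g], which leaves the density of [c + s g] at [y]. *)
Lemma gauss_rotation_pos (f : R -> R) (c a b s : R) : (0 < b)%R -> (0 < s)%R ->
  (a ^+ 2 + b ^+ 2 = s ^+ 2)%R -> continuous f -> (forall x, 0 <= f x)%R ->
  \int[P01]_g \int[P01]_z (f (c + a * g + b * z))%:E = \int[P01]_g (f (c + s * g))%:E.
Proof.
move=> b0 s0 abs cf f0.
have mf := continuous_measurable_fun cf.
have mphi := @measurable_phi R.
have phi0 x : (0 <= @phi R x)%R by rewrite ltW// phi_gt0.
(* [f y] times the joint density of [g] and [y = c + a g + b z]. *)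
pose H (g y : R) : R := (f y * (phi ((y - c - a * g) / b) / b) * phi g)%R.
have mH : measurable_fun [set: measurableTypeR R * measurableTypeR R] (fun p => H p.1 p.2).
  apply: measurable_funM; last exact: measurableT_comp.
  apply: measurable_funM; first exact: measurableT_comp.
  apply: measurable_funM => //; apply: measurableT_comp => //.
  apply: measurable_funM => //; apply: measurable_funB.
    exact: measurable_funB.
  exact: measurable_funM.
have H0 g y : (0 <= H g y)%R.
  by rewrite !mulr_ge0// invr_ge0 ltW.
have cphi (k d : R) : continuous (fun y => f y * (phi ((y - k) / d) / d))%R.
  apply: continuousMf => //; apply: continuousMf; last exact: cst_continuous.
  rewrite (_ : (fun y => _) = fun y => phi (- k / d + d^-1 * y))%R.
    by apply: continuous_comp_affine; exact: continuous_phi.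
  by apply/funext => y; congr phi; ring.
have fphi0 (k d : R) y : (0 < d)%R -> (0 <= f y * (phi ((y - k) / d) / d))%R.
  by move=> d0; rewrite !mulr_ge0// invr_ge0 ltW.
have subst (k d : R) : (0 < d)%R ->
    \int[mu]_y (f y * (phi ((y - k) / d) / d))%:E =
    \int[mu]_z ((f (k + d * z))%:E * (phi z)%:E).
  move=> d0; rewrite (ge0_integral_affine k d0 (cphi k d)); last by move=> x; exact: fphi0.
  apply: eq_integral => z _; rewrite -EFinM; congr EFin.
  rewrite (_ : (k + d * z - k) / d = z)%R; last by field; rewrite gt_eqF.
  by field; rewrite gt_eqF.
have inner (g : R) : \int[P01]_z (f (c + a * g + b * z))%:E * (phi g)%:E = \int[mu]_y (H g y)%:E.
  rewrite ge0_integral_normal//; last 2 first.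
  - apply/measurable_EFinP; apply: continuous_measurable_fun.
    exact: continuous_comp_affine.
  - by move=> z; rewrite lee_fin.
  have mh : measurable_fun [set: measurableTypeR R]
      (fun y => (f y * (phi ((y - (c + a * g)) / b) / b))%:E).
    by apply/measurable_EFinP; apply: continuous_measurable_fun; exact: cphi.
  have h0 (y : measurableTypeR R) :
      setT y -> 0 <= (f y * (phi ((y - (c + a * g)) / b) / b))%:E.
    by move=> _; rewrite lee_fin; exact: fphi0.
  have pg0 : 0 <= (phi g)%:E by rewrite lee_fin.
  rewrite -(subst (c + a * g)%R b b0).
  apply: etrans (esym (ge0_integralZr mu measurableT mh h0 pg0)) _.
  by apply: eq_integral => y _; rewrite -EFinM /H opprD addrA.
rewrite ge0_integral_normal; last 2 first.
- have mF : measurable_fun [set: measurableTypeR R * measurableTypeR R]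
      (fun p => (f (c + a * p.1 + b * p.2))%:E).
    apply/measurable_EFinP; apply: measurableT_comp => //.
    apply: measurable_funD; last exact: measurable_funM.
    by apply: measurable_funD => //; exact: measurable_funM.
  have F0 p : 0 <= (fun p => (f (c + a * p.1 + b * p.2))%:E) p by rewrite lee_fin.
  exact: (@measurable_fun_fubini_tonelli_F _ _ _ _ R P01 _ mF F0).
- by move=> g; apply: integral_ge0 => z _; rewrite lee_fin.
under eq_integral do rewrite inner.
have -> := @fubini_tonelli _ _ _ _ R mu mu (fun p => (H p.1 p.2)%:E); last 2 first.
- exact/measurable_EFinP.
- by move=> p; rewrite lee_fin.
rewrite ge0_integral_normal; last 2 first.
- by apply/measurable_EFinP; apply: continuous_measurable_fun; exact: continuous_comp_affine.
- by move=> g; rewrite lee_fin.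
rewrite -(subst c s s0).
apply: eq_integral => y _.
have bs0 : (b / s != 0)%R by rewrite gt_eqF// divr_gt0.
(* Completing the square in [g]: the law of [g] given [y] is normal with mean [a (y - c) / s ^ 2]
   and standard deviation [b / s]. *)
have E g : H g y = (f y * (phi ((y - c) / s) / s) * normal_pdf (a * (y - c) / s ^+ 2) (b / s) g)%R.
  rewrite /H normal_pdfE// /normal_fun /phi /normal_peak.
  have c0 : (0 < Num.sqrt (2 * pi : R))%R := sqrt2pi_gt0.
  have -> : (Num.sqrt ((b / s) ^+ 2 * pi *+ 2) = (b / s) * Num.sqrt (2 * pi))%R.
    rewrite -mulr_natl mulrCA sqrtrM ?sqr_ge0// sqrtr_sqr ger0_norm//.
    by rewrite divr_ge0// ltW.
  transitivity (f y * (expR (- ((y - c - a * g) / b) ^+ 2 / 2) * expR (- g ^+ 2 / 2))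
    / (Num.sqrt (2 * pi) ^+ 2 * b))%R.
    by field; rewrite !gt_eqF.
  rewrite -expRD.
  have -> : (- ((y - c - a * g) / b) ^+ 2 / 2 + - g ^+ 2 / 2 =
      - ((y - c) / s) ^+ 2 / 2 + - (g - a * (y - c) / s ^+ 2) ^+ 2 / ((b / s) ^+ 2 *+ 2))%R.
    rewrite -[((b / s) ^+ 2 *+ 2)%R]mulr_natl.
    have -> : (g - a * (y - c) / s ^+ 2 = (g * s ^+ 2 - a * (y - c)) / s ^+ 2)%R.
      by field; rewrite gt_eqF.
    have -> : (((y - c) / s) ^+ 2 = (y - c) ^+ 2 / s ^+ 2)%R by rewrite expr_div_n.
    have -> : ((b / s) ^+ 2 = b ^+ 2 / s ^+ 2)%R by rewrite expr_div_n.
    have : (s ^+ 2 != 0)%R by rewrite expf_neq0// gt_eqF.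
    rewrite -abs => abs0; field.
    by rewrite abs0 gt_eqF.
  rewrite expRD.
  by field; rewrite !gt_eqF.
rewrite /=; under eq_integral do rewrite E EFinM.
rewrite ge0_integralZl//.
- by rewrite integral_normal_pdf mule1.
- by apply/measurable_EFinP; exact: measurable_normal_pdf.
- by move=> g _; rewrite lee_fin normal_pdf_ge0.
- by rewrite lee_fin; exact: fphi0.
Qed.

(** Symmetry of the Gaussian allows [b] and [s] to be replaced by their absolute values. If [b = 0],
    the inner integrand is constant and [|s| = |a|]. *)
Lemma gauss_rotation (f : R -> R) (c a b s : R) :
  (a ^+ 2 + b ^+ 2 = s ^+ 2)%R -> continuous f -> (forall x, 0 <= f x)%R ->
  \int[P01]_g \int[P01]_z (f (c + a * g + b * z))%:E = \int[P01]_g (f (c - s * g))%:E.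
Proof.
move=> abs cf f0.
have maff k d : measurable_fun [set: R] (fun z : R => (f (k + d * z))%:E).
  by apply/measurable_EFinP; apply: continuous_measurable_fun; exact: continuous_comp_affine.
have faff0 k d z : 0 <= (f (k + d * z))%:E by rewrite lee_fin.
have flip (k d : R) : \int[P01]_z (f (k - d * z))%:E = \int[P01]_z (f (k + d * z))%:E.
  rewrite -(ge0_integral_normalN (maff k d) (faff0 k d)).
  by apply: eq_integral => z _; rewrite mulrN.
have absd (k d : R) : \int[P01]_z (f (k + `|d| * z))%:E = \int[P01]_z (f (k + d * z))%:E.
  have [d0|d0] := leP 0%R d; first by rewrite ger0_norm.
  by rewrite ltr0_norm// -flip; apply: eq_integral => z _; rewrite mulNr.
rewrite flip -[RHS]absd.
have [b0|b0] := eqVneq b 0%R.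
  have -> : (`|s| = `|a|)%R.
    by rewrite -!sqrtr_sqr -abs b0 expr0n addr0.
  rewrite absd; apply: eq_integral => g _.
  rewrite (eq_integral (fun=> (f (c + a * g))%:E)); last by move=> z _; rewrite b0 mul0r addr0.
  rewrite integral_cst// [X in _ * X](_ : _ = 1) ?mule1//.
  exact: (probability_setT P01).
under eq_integral do rewrite -absd.
apply: gauss_rotation_pos => //.
- by rewrite normr_gt0.
- rewrite normr_gt0 -sqrf_eq0 -abs gt_eqF// ltr_wpDl ?sqr_ge0//.
  by rewrite lt_neqAle sqr_ge0 eq_sym sqrf_eq0 b0.
- by rewrite !real_normK ?num_real.
Qed.


(** Independence is assumed for the shifted variable [e + G], as in the theorem where [e] is
    [sqrt lambda]. Undoing the shift on events shows that the law of [(G, Z)] agrees with the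
    product measure on rectangles, hence everywhere. *)
Lemma expectation_gauss_combination d (T : measurableType d) (P : probability T R)
    (G Z : {RV P >-> R}) (e : R) (f : R -> R) (c a b s : R) :
  std_gaussian G -> std_gaussian Z -> independent P (fun w => e + G w)%R Z ->
  (a ^+ 2 + b ^+ 2 = s ^+ 2)%R -> continuous f -> (forall x, 0 <= f x)%R ->
  \int[P]_w (f (c + a * G w + b * Z w))%:E = \int[P01]_g (f (c - s * g))%:E.
Proof.
move=> sG sZ GZ abs cf f0; rewrite -(gauss_rotation c abs cf f0).
have mf := continuous_measurable_fun cf.
pose X (w : T) : measurableTypeR R * measurableTypeR R := (G w, Z w).
have mX : measurable_fun setT X.
  by apply: measurable_fun_pair; [exact: (measurable_funP G)|exact: (measurable_funP Z)].
have mF : measurable_fun [set: measurableTypeR R * measurableTypeR R]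
    (fun p => (f (c + a * p.1 + b * p.2))%:E).
  apply/measurable_EFinP; apply: measurableT_comp => //.
  apply: measurable_funD; last exact: measurable_funM.
  by apply: measurable_funD => //; exact: measurable_funM.
have F0 (p : measurableTypeR R * measurableTypeR R) : 0 <= (f (c + a * p.1 + b * p.2))%:E.
  by rewrite lee_fin.
have <- := @fubini_tonelli1 _ _ _ _ R P01 P01 _ mF F0.
transitivity (\int[pushforward P X]_p (f (c + a * p.1 + b * p.2))%:E).
  by rewrite ge0_integral_pushforward.
apply: eq_measure_integral => A mA _; apply/esym.
apply: product_measure_unique => // B C mB mC.
rewrite -[LHS]/(P (X @^-1` (B `*` C))).
have -> : X @^-1` (B `*` C) = (fun w => e + G w)%R @^-1` ((fun t => t - e)%R @^-1` B) `&` Z @^-1` C.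
  by apply/seteqP; split => w; rewrite /X /= addrAC subrr add0r.
rewrite GZ//; last first.
  by rewrite -[X in measurable X]setTI; apply: measurable_funB.
congr (_ * _); last exact: sZ.
rewrite -[RHS](sG _ mB); congr (P _).
by apply/seteqP; split => w; rewrite /= addrAC subrr add0r.
Qed.

End gauss_rotation.

(** * The potential in the variables [x] and [s] *)

Section potential.
Context {R : realType}.
Local Notation N := (@gauss_tail R).
Local Notation A := (@inv_mills R).
Local Notation msqrt s := (Num.sqrt (1 + s ^+ 2)).
Implicit Types (f : R -> R) (x s c k u w : R).

Lemma lin_norm k : lin_growth (fun u : R => k + `|u|).
Proof.
split; first by move=> x; apply: cvgD; [exact: cvg_cst|exact: norm_continuous].
exists (`|k| + 1) => u; rewrite (le_trans (ler_normD _ _))// normr_id.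
by have := normr_ge0 k; have := normr_ge0 u; nra.
Qed.

Lemma lin_mills : lin_growth A.
Proof.
split; first exact: continuous_mills.
exists (1 + A 0) => u; rewrite gtr0_norm ?inv_mills_gt0//.
have A0 := @inv_mills_gt0 R 0.
have u0 := normr_ge0 u.
have := inv_mills_le u; have : Num.max u 0 <= `|u| by rewrite ge_max ler_norm normr_ge0.
nra.
Qed.

Lemma quad_sqr_mills : quad_growth (fun u => A u ^+ 2).
Proof. exact: (linM lin_mills lin_mills). Qed.

Lemma lin_derive_quad f (f' : R -> R) :
  (forall u, is_derive u 1 f (f' u)) -> lin_growth f' -> quad_growth f.
Proof.
move=> df [cf' [C f'C]]; split; first by move=> u; exact: is_derive_continuous (df u).
have C0 := lin_growth_ge0 f'C.
exists (`|f 0| + 2 * C) => u.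
have bd : `|f u| <= `|f 0| + C * (1 + `|u|) * `|u| ->
    `|f u| <= (`|f 0| + 2 * C) * (1 + u ^+ 2).
  move=> h; apply: (le_trans h); rewrite -(real_normK (num_real u)).
  have u0 := normr_ge0 u; have f0 := normr_ge0 (f 0).
  have h1 : C * (1 + `|u|) * `|u| <= C * (2 * (1 + `|u| ^+ 2)).
    by rewrite -mulrA ler_wpM2l//; have := sqr_ge0 (`|u| - 1); nra.
  have h2 := mulr_ge0 f0 (sqr_ge0 `|u|); nra.
apply: bd.
have [u0|u0] := leP 0 u.
- have [c /andP[c0 cu] E] := is_derive_MVT u0 (fun z _ => df z).
  rewrite -[f u](subrK (f 0)) addrC (le_trans (ler_normD _ _))// lerD2l E subr0 normrM.
  rewrite ler_wpM2r// (le_trans (f'C _))// ler_wpM2l// lerD2l.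
  by rewrite !ger0_norm// (le_trans c0).
- have [c /andP[c0 cu] E] := is_derive_MVT (ltW u0) (fun z _ => df z).
  have -> : f u = f 0 - f' c * (0 - u) by rewrite -E; ring.
  rewrite (le_trans (ler_normB _ _))// lerD2l sub0r normrM normrN.
  rewrite ler_wpM2r// (le_trans (f'C _))// ler_wpM2l// lerD2l.
  by rewrite !ler0_norm ?lerN2// ltW.
Qed.

Lemma linN f : lin_growth f -> lin_growth (fun u => - f u).
Proof.
move=> [cf [C fC]]; split; first by move=> u; apply: cvgN; exact: cf.
by exists C => u; rewrite normrN.
Qed.

Lemma quad_lntail : quad_growth (fun u => ln (N u)).
Proof. exact: (lin_derive_quad is_derive_lntail (linN lin_mills)). Qed.

Lemma quad_bounded f (B : R) : continuous f -> (forall u, `|f u| <= B) -> quad_growth f.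
Proof.
move=> cf fB; split => //; exists B => u.
have B0 : 0 <= B by apply: le_trans (fB 0).
by rewrite (le_trans (fB u))// ler_peMr// lerDl sqr_ge0.
Qed.

Definition dmills u := A u * (A u - u).

Lemma dmills_bound u : 0 <= dmills u <= 1.
Proof. by rewrite /dmills mills_deriv_ge0 mills_deriv_le1. Qed.

Lemma continuous_dmills : continuous dmills.
Proof.
move=> u; apply: cvgM; first exact: continuous_mills.
by apply: cvgB; [exact: continuous_mills|exact: cvg_id].
Qed.

Lemma is_derive_sqr_mills u : is_derive u 1 (fun u => A u ^+ 2) (2 * A u * dmills u).
Proof. exact: (is_derive_sqrf (is_derive_mills u)). Qed.

(** The second derivative of [A ^ 2], arranged so that its last term is nonpositive, since
    [dmills u <= 1]. *)
Lemma is_derive_2Amills u : is_derive u 1 (fun u => 2 * A u * dmills u)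
  (4 * dmills u ^+ 2 + 2 * A u ^+ 2 * (dmills u - 1)).
Proof.
have dA := is_derive_mills u.
apply: (is_derive_eq (is_deriveMf (is_deriveMf (is_deriveCf 2 u) dA)
  (is_deriveMf dA (is_deriveBf dA (is_deriveIf u))))).
by rewrite /dmills; ring.
Qed.

Lemma lin_2Amills : lin_growth (fun u => 2 * A u * dmills u).
Proof.
split.
  move=> u; apply: cvgM; last exact: continuous_dmills.
  by apply: cvgM; [exact: cvg_cst|exact: continuous_mills].
have [_ [C AC]] := lin_mills.
exists (2 * C) => u; have /andP[d0 d1] := dmills_bound u.
have A0 := @inv_mills_gt0 R u.
have A2 : 0 <= 2 * A u by apply: mulr_ge0 => //; exact: ltW A0.
rewrite (ger0_norm (mulr_ge0 A2 d0)).
have := AC u; rewrite gtr0_norm//; nra.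
Qed.

Lemma quad_d2mills : quad_growth (fun u => 4 * dmills u ^+ 2 + 2 * A u ^+ 2 * (dmills u - 1)).
Proof.
split.
  move=> u; apply: cvgD.
    apply: cvgM; first exact: cvg_cst.
    by apply: cvgM; exact: continuous_dmills.
  apply: cvgM; last by apply: cvgB; [exact: continuous_dmills|exact: cvg_cst].
  by apply: cvgM; [exact: cvg_cst|apply: cvgM; exact: continuous_mills].
have [_ [C AC]] := quad_sqr_mills.
exists (4 + 2 * C) => u; have /andP[d0 d1] := dmills_bound u.
have := AC u; rewrite ger0_norm ?sqr_ge0// => AC'.
have Au := sqr_ge0 (A u); have u2 := sqr_ge0 u.
rewrite ler_norml; apply/andP; split; nra.
Qed.

(** * Means of [ln N], [A] and [A ^ 2] at the rotated margin *)

Section margin.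
Variable c : R.

Definition lntail_mean s := gE (fun w => ln (N (msqrt s * c - s * w))).
Definition mills_mean s := gE (fun w => A (msqrt s * c - s * w)).
Definition mills_sqmean s := gE (fun w => A (msqrt s * c - s * w) ^+ 2).

Lemma quad_margin f s : quad_growth f -> quad_growth (fun w => f (msqrt s * c - s * w)).
Proof.
move=> qf; rewrite (_ : (fun w => _) = fun w => f (msqrt s * c + (- s) * w)).
  exact: quad_comp_affine.
by apply/funext => w; rewrite mulNr.
Qed.

(** For [f = ln N] the expression [f'' + u f'] collapses to [- A (A - u) - u A = - A ^ 2]. *)
Lemma is_derive_lntail_mean s : is_derive s 1 lntail_mean (- (s / (1 + s ^+ 2) * mills_sqmean s)).
Proof.
have d2 u : is_derive u 1 (fun u => - A u) (- dmills u).
  exact: is_deriveNf (is_derive_mills u).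
have qd : quad_growth (fun u => - dmills u).
  apply: (@quad_bounded _ 1); first by move=> u; apply: cvgN; exact: continuous_dmills.
  by move=> u; rewrite normrN; have /andP[d0 d1] := dmills_bound u; rewrite ger0_norm.
apply: (is_derive_eq (is_derive_gE_margin c s is_derive_lntail d2 quad_lntail (linN lin_mills) qd)).
rewrite -mulrN; congr (_ * _); rewrite -mulN1r -gE_Z; last exact: quad_margin quad_sqr_mills.
by congr gE; apply/funext => w; rewrite /dmills; ring.
Qed.

(** [D] is the mean of [f'' + u f'] for [f = A ^ 2]. As [A' = dmills] lies in [[0, 1]] and
    [u <= A u], the integrand is at most [4 + (4 A' - 2) A ^ 2 <= 4 + 2 A ^ 2]. *)
Lemma is_derive_mills_sqmean s :
  exists2 D, is_derive s 1 mills_sqmean (s / (1 + s ^+ 2) * D) & D <= 4 + 2 * mills_sqmean s.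
Proof.
pose u w := msqrt s * c - s * w.
exists (gE (fun w => (4 * dmills (u w) ^+ 2 + 2 * A (u w) ^+ 2 * (dmills (u w) - 1))
    + u w * (2 * A (u w) * dmills (u w)))).
  exact: (is_derive_gE_margin c s is_derive_sqr_mills is_derive_2Amills quad_sqr_mills
    lin_2Amills quad_d2mills).
have qA := quad_margin s quad_sqr_mills.
rewrite -[X in _ <= X + _](gE_C 4) -gE_Z// -gE_D//; [|exact: quadC|exact: quadZ].
apply: gE_le.
- apply: quadD; first exact: quad_margin quad_d2mills.
  have lidU : lin_growth (fun w => msqrt s * c - s * w).
    rewrite (_ : (fun w => _) = fun w => msqrt s * c + (- s) * w); first exact: lin_affine.
    by apply/funext => w; rewrite mulNr.
  apply: (linM lidU).
  rewrite (_ : (fun w => _) = fun w => (fun u => 2 * A u * dmills u) (msqrt s * c + (- s) * w)).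
    exact: (lin_comp_affine _ _ lin_2Amills).
  by apply/funext => w; rewrite mulNr.
- by apply: quadD; [exact: quadC|exact: quadZ].
- move=> w; rewrite -/(u w); move: (u w) => {}u; have /andP[d0 d1] := dmills_bound u.
  have A0 := @inv_mills_gt0 R u; have Au := @inv_mills_ge R u.
  have h1 : dmills u ^+ 2 <= 1 by rewrite expr_le1.
  have h2 : u * A u * dmills u <= A u ^+ 2 * dmills u.
    by rewrite ler_wpM2r// expr2 ler_wpM2r// ltW.
  nra.
Qed.

Lemma mills_sqmean_ge0 s : 0 <= mills_sqmean s.
Proof. by apply: gE_ge0 => w; exact: sqr_ge0. Qed.

End margin.

(** Bounds for the means of [A ^ 2] and [A], after division by [1 + s ^ 2] and by its square root.
    They are uniform in [s] and in [c <= k]; this is how the threshold on [alpha] comes to depend on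
    [kappa] through its positive part only. *)
Definition envelope2 k := gE (fun w => (A 0 + k + `|w|) ^+ 2).
Definition envelope1 k := gE (fun w => A 0 + k + `|w|).

Lemma envelope2_ge0 k : 0 <= envelope2 k.
Proof. by apply: gE_ge0 => w; exact: sqr_ge0. Qed.

Lemma envelope1_ge0 k : 0 <= k -> 0 <= envelope1 k.
Proof. by move=> k0; apply: gE_ge0 => w; rewrite !addr_ge0// ltW// inv_mills_gt0. Qed.

Lemma msqrt_ge1 s : 1 <= msqrt s.
Proof. by rewrite -[leLHS]sqrtr1 ler_wsqrtr// lerDl sqr_ge0. Qed.

Lemma mills_margin_le k c s w : 0 <= k -> c <= k ->
  A (msqrt s * c - s * w) <= msqrt s * (A 0 + k + `|w|).
Proof.
move=> k0 ck; have A0 := @inv_mills_gt0 R 0; have m1 := msqrt_ge1 s.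
have sm : `|s| <= msqrt s by rewrite -(sqrtr_sqr s) ler_wsqrtr// lerDr.
have w0 := normr_ge0 w.
have h : - (s * w) <= msqrt s * `|w|.
  rewrite (le_trans (ler_norm _))// normrN normrM ler_wpM2r//.
rewrite (le_trans (inv_mills_le _))//.
rewrite mulrDr mulrDr -addrA lerD//; first by rewrite ler_peMl// ltW.
rewrite ge_max; apply/andP; split; last by rewrite addr_ge0// mulr_ge0// (le_trans _ m1).
by rewrite lerD// ler_wpM2l// (le_trans _ m1).
Qed.

Lemma mills_mean_le k c s : 0 <= k -> c <= k -> mills_mean c s <= msqrt s * envelope1 k.
Proof.
move=> k0 ck; have qb := lin_quad (lin_norm (A 0 + k)).
rewrite /envelope1 -gE_Z//; apply: gE_le; last by move=> w; exact: mills_margin_le.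
- exact: quad_margin (lin_quad lin_mills).
- exact: quadZ.
Qed.

Lemma mills_sqmean_le k c s : 0 <= k -> c <= k -> mills_sqmean c s <= (1 + s ^+ 2) * envelope2 k.
Proof.
move=> k0 ck; have qb := linM (lin_norm (A 0 + k)) (lin_norm (A 0 + k)).
rewrite /envelope2 -gE_Z//; apply: gE_le.
- exact: quad_margin quad_sqr_mills.
- exact: quadZ.
- move=> w.
  have -> : (1 + s ^+ 2) * (A 0 + k + `|w|) ^+ 2 = (msqrt s * (A 0 + k + `|w|)) ^+ 2.
    by rewrite exprMn sqr_sqrt1D.
  have h := mills_margin_le s w k0 ck.
  have h0 := ltW (inv_mills_gt0 (msqrt s * c - s * w)).
  by rewrite !expr2; apply: ler_pM.
Qed.

Lemma lntail_mean_tangent c c' s :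
  lntail_mean c' s <= lntail_mean c s - msqrt s * (c' - c) * mills_mean c s.
Proof.
have qA := lin_quad lin_mills.
rewrite -mulNr -gE_Z; last exact: quad_margin.
rewrite -gE_D; [|exact: quad_margin quad_lntail|by apply: quadZ; exact: quad_margin].
apply: gE_le; first exact: quad_margin quad_lntail.
  by apply: quadD; [exact: quad_margin quad_lntail|by apply: quadZ; exact: quad_margin].
move=> w; rewrite (le_trans (lntail_tangent (msqrt s * c - s * w) _))//.
by rewrite le_eqVlt; apply/orP; left; apply/eqP; ring.
Qed.

End potential.

Section saddle.
Context {R : realType}.
Local Notation A := (@inv_mills R).
Local Notation msqrt s := (Num.sqrt (1 + s ^+ 2)).
Implicit Types (f : R -> R) (x s c k u w : R).

(** Near [t0] both [|a|] and [|b|] exceed their values at [t0] by at most 1, so [quad_affine_bound]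
    provides a dominating function. *)
Lemma gE_comp_continuous f (a b : R -> R) : quad_growth f -> continuous a -> continuous b ->
  continuous (fun t => gE (fun w => f (a t - b t * w))).
Proof.
move=> qf ca cb t0; have [cf [C fC]] := qf.
have C0 := quad_growth_ge0 fC.
have [e e0 ab] : exists2 e : R, 0 < e & forall t, t0 - e < t < t0 + e ->
    `|a t| <= `|a t0| + 1 /\ `|b t| <= `|b t0| + 1.
  have bdd (h : R -> R) : continuous h -> \forall t \near t0, `|h t| <= `|h t0| + 1.
    move=> ch; have /cvgrPdist_le /(_ _ ltr01) := ch t0.
    apply: filterS => t ht.
    by rewrite -[h t](subrK (h t0)) addrC (le_trans (ler_normD _ _))// lerD2l distrC.
  have := filterI (bdd a ca) (bdd b cb) => -[e /= e0 he].
  exists e => // t te; apply: he; rewrite /= distrC ltr_norml; lra.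
pose B := C * (1 + 2 * (`|a t0| + 1) ^+ 2 + 2 * (`|b t0| + 1) ^+ 2).
apply: (@gE_continuous _ _ t0 (t0 - e) (t0 + e) B).
- lra.
- move=> t; rewrite (_ : (fun w => _) = fun w => f (a t + (- b t) * w)).
    exact: quad_comp_affine.
  by apply/funext => w; rewrite mulNr.
- move=> t w /ab[at1 bt1]; rewrite -mulNr (le_trans (quad_affine_bound fC _ _ _))//.
  rewrite ler_wpM2r ?addr_ge0 ?sqr_ge0// /B ler_wpM2l// sqrrN.
  rewrite -(real_normK (num_real (a t))) -(real_normK (num_real (b t))).
  by rewrite !lerD ?ler_wpM2l// lerXn2r ?nnegrE ?addr_ge0.
- move=> w t; apply: (continuous_comp (f := fun t => a t - b t * w)); last exact: cf.
  by apply: cvgB; [exact: ca|apply: cvgM; [exact: cb|exact: cvg_cst]].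
Qed.

Lemma continuous_msqrt : continuous (fun s : R => msqrt s).
Proof. by move=> s; exact: is_derive_continuous (is_derive_sqrt1D s). Qed.

(** * Solving the two equations by the intermediate value theorem *)

Section existence.
Variables (kappa lambda alpha : R).
Local Notation k := (Num.max kappa 0).
Hypothesis alpha0 : 0 < alpha.
Hypothesis alpha_env1 : alpha * Num.sqrt lambda * envelope1 k <= 2^-1.
Hypothesis alpha_env2 : alpha * (4 + 4 * envelope2 k) < 1.

Let k0 : 0 <= k. Proof. by rewrite le_max lexx orbT. Qed.

Let rl := Num.sqrt lambda.

Let rl0 : 0 <= rl. Proof. exact: sqrtr_ge0. Qed.

Let marginE y s w : msqrt s * kappa - y * rl - s * w =
  msqrt s * (kappa - y / msqrt s * rl) - s * w.
Proof.
by have m0 := sqrt1D_gt0 s; field; rewrite gt_eqF.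
Qed.

Let le_k y s : 0 <= y -> kappa - y / msqrt s * rl <= k.
Proof.
move=> y0; rewrite (@le_trans _ _ kappa)//; last by rewrite le_max lexx.
by rewrite lerBlDr lerDl mulr_ge0// divr_ge0// sqrtr_ge0.
Qed.

(** With [y = msqrt s * x], the first equation reads [K y s = 0]. *)
Let K (y s : R) : R := y - alpha * rl * gE (fun w => A (msqrt s * kappa - y * rl - s * w)).

Let quadU f y s : quad_growth f -> quad_growth (fun w => f (msqrt s * kappa - y * rl - s * w)).
Proof.
move=> qf; rewrite (_ : (fun w => _) = fun w => f (msqrt s * kappa - y * rl + (- s) * w)).
  exact: quad_comp_affine.
by apply/funext => w; rewrite mulNr.
Qed.

(** Raising [y] lowers the argument of the nondecreasing [A], so the subtracted term cannot
    increase. *)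
Let K_mono y y' s : y <= y' -> y' - y <= K y' s - K y s.
Proof.
move=> yy'; rewrite /K -subr_ge0.
set g := gE _; set g' := gE _.
have : g <= g'.
  apply: gE_le; [exact: quadU (lin_quad lin_mills)|exact: quadU (lin_quad lin_mills)|].
  by move=> w; apply: inv_mills_ndecr; rewrite lerB// lerB// ler_wpM2r.
move=> gg'; have -> : y' - alpha * rl * g - (y - alpha * rl * g') - (y' - y) =
  alpha * rl * (g' - g) by ring.
by rewrite mulr_ge0 ?subr_ge0// mulr_ge0// ltW.
Qed.

Let K_cont_y s : continuous (K ^~ s).
Proof.
move=> y; apply: cvgB; first exact: cvg_id.
apply: cvgM; first exact: cvg_cst.
apply: (@gE_comp_continuous A (fun y => msqrt s * kappa - y * rl) (fun=> s)).
- exact: lin_quad lin_mills.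
- by move=> z; apply: cvgB; [exact: cvg_cst|apply: cvgM; [exact: cvg_id|exact: cvg_cst]].
- by move=> z; exact: cvg_cst.
Qed.

Let K_cont_s y : continuous (K y).
Proof.
move=> s; apply: cvgB; first exact: cvg_cst.
apply: cvgM; first exact: cvg_cst.
apply: (@gE_comp_continuous A (fun s => msqrt s * kappa - y * rl) (fun s => s)).
- exact: lin_quad lin_mills.
- move=> z; apply: cvgB; last exact: cvg_cst.
  by apply: cvgM; [exact: continuous_msqrt|exact: cvg_cst].
- by move=> z; exact: cvg_id.
Qed.

(** [K] is nonpositive at [y = 0], and nonnegative at [y = msqrt s / 2] by [alpha_env1]. The upper
    bound on [y] is what gives [x <= 1/2]. *)
Let K_root s : exists y, [/\ 0 <= y, y <= msqrt s / 2 & K y s = 0].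
Proof.
have m0 := sqrt1D_gt0 s.
have Y0 : 0 <= msqrt s / 2 by rewrite divr_ge0// ltW.
have [||y] := @IVT R (K ^~ s) 0 (msqrt s / 2) 0 Y0.
- by apply: continuous_subspaceT => z; exact: K_cont_y.
- rewrite ge_min le_max; apply/andP; split; apply/orP.
    left; rewrite /K sub0r oppr_le0 mulr_ge0 ?mulr_ge0 ?(ltW alpha0)//.
    by apply: gE_ge0 => w; rewrite ltW// inv_mills_gt0.
  right; rewrite /K subr_ge0.
  have -> : (fun w => A (msqrt s * kappa - msqrt s / 2 * rl - s * w)) =
     fun w => A (msqrt s * (kappa - (msqrt s / 2) / msqrt s * rl) - s * w).
    by apply/funext => w; rewrite marginE.
  rewrite (le_trans (ler_wpM2l _ (mills_mean_le s k0 (le_k s Y0))))//.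
    by rewrite mulr_ge0// ltW.
  rewrite mulrCA ler_wpM2l// ltW//.
- rewrite in_itv/= => /andP[y0 yY] Ky; exists y; split => //.
Qed.

Let Y s := projT1 (cid (K_root s)).
Let Y_ge0 s : 0 <= Y s. Proof. by rewrite /Y; case: cid => y []. Qed.
Let Y_le s : Y s <= msqrt s / 2. Proof. by rewrite /Y; case: cid => y []. Qed.
Let Y_root s : K (Y s) s = 0. Proof. by rewrite /Y; case: cid => y []. Qed.

(** Slope at least 1 bounds the distance to the root by the size of the value; continuity of [Y]
    then follows from that of [K] in [s]. *)
Let Y_dist y s : `|Y s - y| <= `|K y s|.
Proof.
have [h|/ltW h] := leP y (Y s).
  rewrite ger0_norm ?subr_ge0// (le_trans (K_mono s h))// Y_root sub0r.
  by rewrite (le_trans (ler_norm _))// normrN.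
rewrite ler0_norm ?subr_le0// opprB (le_trans (K_mono s h))// Y_root subr0.
exact: ler_norm.
Qed.

Let Y_cont : continuous Y.
Proof.
move=> s0; apply/cvgrPdist_le => e e0.
have /cvgrPdist_le /(_ _ e0) := K_cont_s (y := Y s0) (x := s0).
apply: filterS => s; rewrite Y_root sub0r normrN => h.
by rewrite distrC (le_trans (Y_dist _ _)).
Qed.

Lemma saddle_equations_solvable : exists x s,
  [/\ 0 <= x <= 2^-1, 0 <= s,
     msqrt s * x = alpha * Num.sqrt lambda * mills_mean (kappa - x * Num.sqrt lambda) s &
     (1 + s ^+ 2) * (1 - x ^+ 2) - 1 = alpha * mills_sqmean (kappa - x * Num.sqrt lambda) s].
Proof.
(* [W s = 0] is the second equation at [x = Y s / msqrt s], because [(1 + s ^ 2) (1 - x ^ 2) - 1 = s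
   ^ 2 - Y s ^ 2]. *)
pose W s := s ^+ 2 - Y s ^+ 2 - alpha * gE (fun w => A (msqrt s * kappa - Y s * rl - s * w) ^+ 2).
have cW : continuous W.
  move=> s; apply: cvgB.
    by apply: cvgB; [apply: cvgM; exact: cvg_id|apply: cvgM; exact: Y_cont].
  apply: cvgM; first exact: cvg_cst.
  apply: (@gE_comp_continuous (fun u => A u ^+ 2)
    (fun s => msqrt s * kappa - Y s * rl) (fun s => s)).
  - exact: quad_sqr_mills.
  - move=> z; apply: cvgB; apply: cvgM;
      [exact: continuous_msqrt|exact: cvg_cst|exact: Y_cont|exact: cvg_cst].
  - by move=> z; exact: cvg_id.
have E2E s : gE (fun w => A (msqrt s * kappa - Y s * rl - s * w) ^+ 2) =
    mills_sqmean (kappa - Y s / msqrt s * rl) s.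
  by congr gE; apply/funext => w; rewrite marginE.
have E1E s : gE (fun w => A (msqrt s * kappa - Y s * rl - s * w)) =
    mills_mean (kappa - Y s / msqrt s * rl) s.
  by congr gE; apply/funext => w; rewrite marginE.
have C1k := envelope2_ge0 k.
(* At [s = 2] both [Y 2 ^ 2] and [alpha] times the mean of [A ^ 2] are at most 5/4, using
   [alpha * envelope2 k < 1/4], so [W 2 >= 4 - 5/2 > 0]. *)
have [||s] := @IVT R W 0 2 0 (ler0n R 2).
- exact: continuous_subspaceT.
- rewrite ge_min le_max; apply/andP; split; apply/orP.
    left; rewrite /W E2E expr0n sub0r subr_le0 (@le_trans _ _ 0)// ?oppr_le0 ?sqr_ge0//.
    by rewrite mulr_ge0 ?mills_sqmean_ge0// ltW.
  right; rewrite /W E2E.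
  have Y2 : Y 2 ^+ 2 <= (msqrt 2 / 2) ^+ 2.
    by rewrite lerXn2r ?nnegrE ?Y_ge0 ?Y_le// divr_ge0// sqrtr_ge0.
  have := sqr_sqrt1D (2 : R) => m2.
  have e2 := mills_sqmean_le 2 k0 (le_k 2 (Y_ge0 2)).
  have ae2 := ler_wpM2l (ltW alpha0) e2.
  have m24 : (msqrt 2 / 2) ^+ 2 = 5 / 4 :> R by rewrite expr_div_n m2; field.
  have aC : alpha * envelope2 k < 4^-1 by move: alpha_env2 alpha0; lra.
  have a5 : alpha * ((1 + 2 ^+ 2) * envelope2 k) = 5 * (alpha * envelope2 k) by ring.
  rewrite a5 in ae2; rewrite m24 in Y2; lra.
- rewrite in_itv/= => /andP[s0 s2] Ws.
have m0 := sqrt1D_gt0 s.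
exists (Y s / msqrt s), s; split => //.
- by rewrite divr_ge0 ?Y_ge0 ?(ltW m0)//= ler_pdivrMr// mulrC Y_le.
- rewrite mulrCA divff ?gt_eqF// mulr1.
  have := Y_root s; rewrite /K => /eqP; rewrite subr_eq0 => /eqP {1}->.
  by rewrite E1E.
- rewrite -/rl -E2E.
  have p0 : 1 + s ^+ 2 != 0 by rewrite -sqr_sqrt1D expf_neq0// gt_eqF.
  have -> : (1 + s ^+ 2) * (1 - (Y s / msqrt s) ^+ 2) - 1 = s ^+ 2 - Y s ^+ 2.
    by rewrite expr_div_n sqr_sqrt1D; field.
  by move: Ws => /eqP; rewrite subr_eq0 => /eqP.
Qed.

End existence.

(** * Unimodality of the potential in [s], strict concavity estimate in [x] *)

Section unimodal.
Variables (kappa lambda alpha : R).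
Local Notation k := (Num.max kappa 0).
Hypothesis alpha0 : 0 < alpha.
Hypothesis alpha_env2 : alpha * (4 + 4 * envelope2 k) < 1.

(* [potential] and [overlap_gap] are the functions D and h of the introduction. *)
Definition potential x s := alpha * lntail_mean (kappa - x * Num.sqrt lambda) s
  + (2^-1 * ((1 + s ^+ 2) * (1 - x ^+ 2) - 1) - 2^-1 * ln (1 + s ^+ 2)).

Definition overlap_gap x s :=
  (1 + s ^+ 2) * (1 - x ^+ 2) - 1 - alpha * mills_sqmean (kappa - x * Num.sqrt lambda) s.

Lemma is_derive_potential x s :
  is_derive s 1 (potential x) (s / (1 + s ^+ 2) * overlap_gap x s).
Proof.
have p0 : 0 < 1 + s ^+ 2 by rewrite ltr_pwDl// sqr_ge0.
have d1 : is_derive s 1 (fun s => 1 + s ^+ 2) (2 * s).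
  by apply: (is_derive_eq (is_deriveDf (is_deriveCf 1 s) (is_derive_sqrf (is_deriveIf s)))); ring.
apply: (is_derive_eq (is_deriveDf (is_deriveMf (is_deriveCf alpha s) (is_derive_lntail_mean _ s))
  (is_deriveBf (is_deriveMf (is_deriveCf 2^-1 s)
     (is_deriveBf (is_deriveMf d1 (is_deriveCf (1 - x ^+ 2) s)) (is_deriveCf 1 s)))
   (is_deriveMf (is_deriveCf 2^-1 s)
     (is_derive1_compf (g := fun s => 1 + s ^+ 2) (is_derive1_ln p0) d1))))).
by rewrite /overlap_gap; field; rewrite gt_eqF.
Qed.

(** With [p = 1 + z ^ 2], the derivative has the sign of [2 p (1 - x ^ 2) - alpha D]. Here [alpha D
    <= alpha (4 + 4 envelope2 k) p < p], while [x <= 1/2] gives [p <= 2 p (1 - x ^ 2)]. *)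
Lemma overlap_gap_incr x s s' : 0 <= x <= 2^-1 -> 0 <= s -> s < s' ->
  overlap_gap x s < overlap_gap x s'.
Proof.
move=> /andP[x0 x1] s0 ss'.
have x2 : x ^+ 2 <= 2^-1.
  by rewrite expr2 (le_trans (ler_wpM2l x0 x1))//; lra.
have x3 : 1 <= 2 * (1 - x ^+ 2) by lra.
have k0 : 0 <= k by rewrite le_max lexx orbT.
pose c := kappa - x * Num.sqrt lambda.
have ck : c <= k.
  rewrite (@le_trans _ _ kappa)//; last by rewrite le_max lexx.
  by rewrite lerBlDr lerDl mulr_ge0// sqrtr_ge0.
have [D dD DE] : exists2 D : R -> R,
    forall z : R, is_derive z 1 (mills_sqmean c) (z / (1 + z ^+ 2) * D z) &
    forall z, D z <= 4 + 2 * mills_sqmean c z.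
  have /choice[D DP] : forall z : R, exists D,
      is_derive z 1 (mills_sqmean c) (z / (1 + z ^+ 2) * D) /\ D <= 4 + 2 * mills_sqmean c z.
    by move=> z; have [D] := is_derive_mills_sqmean c z; exists D.
  by exists D => z; have [] := DP z.
have dh (z : R) : is_derive z 1 (overlap_gap x)
    (z / (1 + z ^+ 2) * (2 * (1 + z ^+ 2) * (1 - x ^+ 2) - alpha * D z)).
  have p0 : 0 < 1 + z ^+ 2 by rewrite ltr_pwDl// sqr_ge0.
  apply: (is_derive_eq (is_deriveBf (is_deriveBf (is_deriveMf
    (is_deriveDf (is_deriveCf 1 z) (is_derive_sqrf (is_deriveIf z))) (is_deriveCf (1 - x ^+ 2) z))
    (is_deriveCf 1 z)) (is_deriveMf (is_deriveCf alpha z) (dD z)))).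
  by field; rewrite gt_eqF.
have [z /andP[sz zs'] E] := is_derive_MVT_lt ss' (fun z _ => dh z).
rewrite -subr_gt0 E mulr_gt0 ?subr_gt0//.
have z0 : 0 < z by rewrite (le_lt_trans s0).
have p1 : 1 <= 1 + z ^+ 2 by rewrite lerDl sqr_ge0.
rewrite mulr_gt0 ?divr_gt0 ?subr_gt0//; first exact: lt_le_trans p1.
have := ler_wpM2l (ltW alpha0) (DE z).
have := ler_wpM2l (ltW alpha0) (mills_sqmean_le z k0 ck).
have C1k := envelope2_ge0 k.
have aC := mulr_ge0 (ltW alpha0) C1k.
set p := 1 + z ^+ 2 in p1 *; set e := mills_sqmean _ z; set d := D z => h1 h2.
have h3 : alpha * (4 + 4 * envelope2 k) * p < p by rewrite gtr_pMl// (lt_le_trans _ p1).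
have h4 : alpha * 4 <= alpha * 4 * p by rewrite ler_peMr// mulr_ge0// ltW.
have h5 : alpha * (p * envelope2 k) = alpha * envelope2 k * p by ring.
have h6 : p <= p * (2 * (1 - x ^+ 2)).
  by rewrite ler_peMr// (le_trans ler01 p1).
have h7 := mulr_ge0 aC (le_trans ler01 p1).
clear -h1 h2 h3 h4 h5 h6 h7; lra.
Qed.

(** The derivative of the potential has the sign of the gap, which increases strictly through 0 at
    [s]. *)
Lemma potential_min x s s' : 0 <= x <= 2^-1 -> 0 <= s -> 0 <= s' ->
  overlap_gap x s = 0 -> s' != s -> potential x s < potential x s'.
Proof.
move=> x01 s0 s'0 hs s's.
have dp := is_derive_potential x.
have p0 (z : R) : 0 < 1 + z ^+ 2 by rewrite ltr_pwDl// sqr_ge0.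
have [ss'|s'lt|E] := ltgtP s s'; last by rewrite E eqxx in s's.
- have [z /andP[sz zs'] E] := is_derive_MVT_lt ss' (fun z _ => dp z).
  have z0 := le_lt_trans s0 sz.
  rewrite -subr_gt0 E mulr_gt0 ?subr_gt0// mulr_gt0 ?divr_gt0//.
  by rewrite -hs; exact: overlap_gap_incr.
- have [z /andP[sz zs'] E] := is_derive_MVT_lt s'lt (fun z _ => dp z).
  have z0 := le_lt_trans s'0 sz.
  rewrite -subr_lt0 E pmulr_llt0 ?subr_gt0// pmulr_rlt0 ?divr_gt0//.
  by rewrite -hs; apply: overlap_gap_incr => //; exact: ltW.
Qed.

(** The condition on [s'] says that it corresponds to some [q <= 0]; up to that point the gap is
    nonpositive. This serves the values of [x] for which a given [s] has no admissible [q]. *)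
Lemma potential_nincr x s s' : 0 <= s -> s <= s' -> (1 + s' ^+ 2) * (1 - x ^+ 2) <= 1 ->
  -1 < x < 1 -> potential x s' <= potential x s.
Proof.
move=> s0 ss' h x1; have x2 : x ^+ 2 < 1 by nra.
apply: (is_derive_nincr ss' (f' := fun z => z / (1 + z ^+ 2) * overlap_gap x z)).
  by move=> z _; exact: is_derive_potential.
move=> z /andP[sz zs']; rewrite mulr_ge0_le0//.
  by rewrite divr_ge0 ?(le_trans s0 sz)// addr_ge0 ?sqr_ge0.
have e2 := mulr_ge0 (ltW alpha0) (mills_sqmean_ge0 (kappa - x * Num.sqrt lambda) z).
rewrite /overlap_gap; have : z ^+ 2 <= s' ^+ 2.
  by rewrite lerXn2r ?nnegrE ?(le_trans s0)// (le_trans s0 sz).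
nra.
Qed.

(** Tangent inequality for [ln N]: by the first equation its linear term is [m ^ 2 x (x' - x)],
    which completes the square with [- m ^ 2 (x' ^ 2 - x ^ 2) / 2]. *)
Lemma potential_concave x x' s :
  msqrt s * x = alpha * Num.sqrt lambda * mills_mean (kappa - x * Num.sqrt lambda) s ->
  potential x' s <= potential x s - 2^-1 * (1 + s ^+ 2) * (x' - x) ^+ 2.
Proof.
move=> E; have m2 := sqr_sqrt1D s.
have := ler_wpM2l (ltW alpha0)
  (lntail_mean_tangent (kappa - x * Num.sqrt lambda) (kappa - x' * Num.sqrt lambda) s).
rewrite /potential; set m := msqrt s in E m2 *; rewrite -m2.
set e1 := mills_mean _ s in E *; set r := Num.sqrt lambda in E *.
have -> : alpha * (lntail_mean (kappa - x * r) s - m * (kappa - x' * r - (kappa - x * r)) * e1) =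
  alpha * lntail_mean (kappa - x * r) s + m * (x' - x) * (alpha * r * e1) by ring.
rewrite -E; set a := lntail_mean _ _; set a' := lntail_mean _ _; set b := ln _.
clear; lra.
Qed.

End unimodal.

End saddle.

(** * The saddle point *)

Section conclusion.
Context {R : realType} {d : measure_display} {T : measurableType d} {P : probability T R}.
Local Notation N := (@gauss_tail R).
Local Notation A := (@inv_mills R).
Local Notation msqrt s := (Num.sqrt (1 + s ^+ 2)).
Variables (kappa lambda alpha : R) (G Z : {RV P >-> R}).
Local Notation S := (fun w : T => Num.sqrt lambda + G w).
Hypotheses (sG : std_gaussian G) (sZ : std_gaussian Z) (SZ : independent P S Z).

(* The value of [s] that corresponds to the pair [(x, q)]. *)
Definition spread (x q : R) := Num.sqrt (((1 - x ^+ 2) * (1 - q))^-1 - 1).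

Lemma sqr_lt1 (x : R) : -1 < x < 1 -> 0 < 1 - x ^+ 2.
Proof. by move=> /andP[x1 x2]; nra. Qed.

Lemma spread_sqr (x q : R) : -1 < x < 1 -> 0 <= q < 1 ->
  1 + spread x q ^+ 2 = ((1 - x ^+ 2) * (1 - q))^-1.
Proof.
move=> /sqr_lt1 x1 /andP[q0 q1].
have p0 : 0 < (1 - x ^+ 2) * (1 - q) by rewrite mulr_gt0// subr_gt0.
have p1 : (1 - x ^+ 2) * (1 - q) <= 1.
  have := sqr_ge0 x; nra.
rewrite /spread sqr_sqrtr ?subr_ge0; last by rewrite invf_ge1.
by rewrite addrC subrK.
Qed.

Lemma spread_uniq (x q s : R) : -1 < x < 1 -> 0 <= q < 1 -> 0 <= s ->
  (1 + s ^+ 2) * (1 - x ^+ 2) * (1 - q) = 1 -> spread x q = s.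
Proof.
move=> x1 q1 s0 E; have x2 := sqr_lt1 x1; have /andP[_ q2] := q1.
have p0 : (1 - x ^+ 2) * (1 - q) != 0 by rewrite mulf_neq0// gt_eqF// subr_gt0.
have sE : spread x q ^+ 2 = s ^+ 2.
  apply: (addrI 1); rewrite spread_sqr//; apply: (mulIf p0).
  by rewrite mulVf// mulrA E.
by apply/eqP; rewrite -(eqrXn2 (n := 2))// ?sqrtr_ge0// sE.
Qed.

(** The normalized margin equals [m c - m x G - m r Z] with [r ^ 2 = (1 - x ^ 2) q]. Since
    [1 - x ^ 2 - r ^ 2 = m ^ -2], the squared coefficients of [G] and [Z] sum to
    [m ^ 2 - 1 = s ^ 2]. *)
Lemma expectation_margin (f : R -> R) (x q : R) : quad_growth f -> (forall u, 0 <= f u) ->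
  -1 < x < 1 -> 0 <= q < 1 ->
  (\int[P]_w (f (normalized_margin kappa S Z x q w))%:E =
   (gE (fun w => f (msqrt (spread x q) * (kappa - x * Num.sqrt lambda) - spread x q * w)))%:E)%E.
Proof.
move=> qf f0 x1 q1; have x2 := sqr_lt1 x1; have /andP[q0 q2] := q1.
set s := spread x q; set m := msqrt s; set c := kappa - _.
have p0 : 0 < (1 - x ^+ 2) * (1 - q) by rewrite mulr_gt0// subr_gt0.
have mE : m = (Num.sqrt ((1 - x ^+ 2) * (1 - q)))^-1.
  by rewrite /m /s spread_sqr// sqrtrV// ltW.
have m2 : m ^+ 2 = ((1 - x ^+ 2) * (1 - q))^-1 by rewrite sqr_sqrt1D spread_sqr.
pose r := Num.sqrt ((1 - x ^+ 2) * q).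
have r2 : r ^+ 2 = (1 - x ^+ 2) * q by rewrite sqr_sqrtr// mulr_ge0// ltW.
have abs : (- (m * x)) ^+ 2 + (- (m * r)) ^+ 2 = s ^+ 2.
  apply: (addrI 1); rewrite -sqr_sqrt1D -/m !sqrrN !exprMn r2 m2.
  field; rewrite !gt_eqF// subr_gt0//.
have [cf _] := qf.
have := expectation_gauss_combination (m * c) sG sZ SZ abs cf f0.
rewrite /gE /Rintegral fineK; last first.
  by apply: integrable_fin_num => //; exact: quad_integrable (quad_margin _ _ qf).
move=> <-; apply: eq_integral => w _; congr ((f _)%:E).
by rewrite /normalized_margin -mE -/r /c; ring.
Qed.

Lemma Phi_potential (x q : R) : -1 < x < 1 -> 0 <= q < 1 ->
  Phi P kappa alpha S Z x q = (potential kappa lambda alpha x (spread x q))%:E.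
Proof.
move=> x1 q1; have x2 := sqr_lt1 x1; have /andP[q0 q2] := q1.
have q3 : 0 < 1 - q by rewrite subr_gt0.
have E : 'E_P[fun w => ln (N (normalized_margin kappa S Z x q w))]%E =
   (lntail_mean (kappa - x * Num.sqrt lambda) (spread x q))%:E.
  (* [expectation_margin] is for nonnegative functions, hence the passage to [- ln N]. *)
  have qN : quad_growth (fun u => - ln (N u)).
    by under eq_fun do rewrite -mulN1r; apply: quadZ; exact: quad_lntail.
  have N0 u : 0 <= - ln (N u) by rewrite oppr_ge0 lntail_le0.
  have := expectation_margin qN N0 x1 q1.
  under [in X in _ = X%:E]eq_fun do rewrite -mulN1r.
  rewrite gE_Z; last exact: quad_margin quad_lntail.
  rewrite mulN1r EFinN => h.
  rewrite unlock -[RHS]oppeK -h -integral_ge0N//; last first.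
    by move=> w _; rewrite lee_fin.
  by apply: eq_integral => w _; rewrite /= opprK.
rewrite /Phi E -EFinM -EFinD /potential; congr (_ + _)%:E.
rewrite spread_sqr// lnV ?posrE ?mulr_gt0// mulrN opprK; congr (_ + _).
by field; rewrite !gt_eqF.
Qed.

Hypotheses (lambda0 : 0 < lambda) (alpha0 : 0 < alpha)
  (alpha_env1 : alpha * Num.sqrt lambda * envelope1 (Num.max kappa 0) <= 2^-1)
  (alpha_env2 : alpha * (4 + 4 * envelope2 (Num.max kappa 0)) < 1).

Lemma saddle_point_unique : exists x q : R,
  [/\ uniquely_achieved_at P kappa alpha S Z x q,
      (x / Num.sqrt (1 - x ^+ 2))%:E =
        ((alpha * Num.sqrt (lambda * (1 - q)))%:E *
         'E_P[fun w => inv_mills (normalized_margin kappa S Z x q w)])%E &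
      (q / (1 - q))%:E =
        (alpha%:E *
         'E_P[fun w => (inv_mills (normalized_margin kappa S Z x q w)) ^+ 2]%R)%E].
Proof.
have [x [s [/andP[x0 x1] s0 eq1 eq2]]] := saddle_equations_solvable alpha0 alpha_env1 alpha_env2.
have xI : -1 < x < 1 by lra.
have x2 := sqr_lt1 xI.
(* [p] is to be [1 / (1 - q)]; the second equation gives [p >= 1], so that [q = 1 - 1 / p] is
   admissible. *)
pose p := (1 + s ^+ 2) * (1 - x ^+ 2).
have e2 : 0 <= alpha * mills_sqmean (kappa - x * Num.sqrt lambda) s.
  by rewrite mulr_ge0 ?mills_sqmean_ge0// ltW.
have p1 : 1 <= p by rewrite -subr_ge0 /p eq2.
have p0 : 0 < p by rewrite (lt_le_trans _ p1).
pose q := 1 - p^-1.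
have q01 : 0 <= q < 1.
  by rewrite subr_ge0 invf_le1// p1/= ltrBlDr ltrDl invr_gt0.
have q1 : 1 - q = p^-1 by rewrite /q opprB addrC subrK.
have sq : spread x q = s.
  by apply: spread_uniq => //; rewrite -/p q1 divff ?gt_eqF.
have gap0 : overlap_gap kappa lambda alpha x s = 0 by rewrite /overlap_gap eq2 subrr.
have x01 : 0 <= x <= 2^-1 by rewrite x0.
have min_s q' : 0 <= q' < 1 -> q' != q ->
    (potential kappa lambda alpha x s < potential kappa lambda alpha x (spread x q')).
  move=> q'01 q'q; apply: potential_min => //; first exact: sqrtr_ge0.
  apply: contraNneq q'q => ss.
  have := spread_sqr xI q'01; rewrite ss => E.
  have /andP[_ q'1] := q'01.
  have q'2 : 1 - q' != 0 by rewrite gt_eqF// subr_gt0.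
  apply/eqP; apply: oppr_inj; apply: (addrI 1).
  by rewrite q1 /p E invfM invrK mulrAC divff ?mul1r// gt_eqF.
have infE : inf_Phi P kappa alpha S Z x = (potential kappa lambda alpha x s)%:E.
  apply/eqP; rewrite eq_le; apply/andP; split.
    by apply: ereal_inf_lbound; exists q => //; rewrite Phi_potential// sq.
  apply: le_ereal_inf_tmp => _ [q' /= q'01 <-]; rewrite Phi_potential// lee_fin.
  by have [->|/(min_s _ q'01)/ltW//] := eqVneq q' q; rewrite sq.
(* The infimum is tested at the [q'] whose spread is [s] if it is nonnegative. Otherwise it is
   tested at [q = 0], whose spread is at least [s], and [potential_nincr] compares the two
   values. *)
have inf_le x' : -1 < x' < 1 ->
    (inf_Phi P kappa alpha S Z x' <= (potential kappa lambda alpha x' s)%:E)%E.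
  move=> x'I; have x'2 := sqr_lt1 x'I.
  have [h|h] := leP 1 ((1 + s ^+ 2) * (1 - x' ^+ 2)).
    pose q' := 1 - ((1 + s ^+ 2) * (1 - x' ^+ 2))^-1.
    have h0 : 0 < (1 + s ^+ 2) * (1 - x' ^+ 2) by rewrite (lt_le_trans _ h).
    have q'01 : 0 <= q' < 1.
      by rewrite subr_ge0 invf_le1// h/= ltrBlDr ltrDl invr_gt0.
    apply: ereal_inf_lbound; exists q' => //; rewrite Phi_potential//.
    rewrite (@spread_uniq _ _ s)// /q' opprB [X in _ * X]addrC subrK divff// gt_eqF//.
  have q'01 : 0 <= (0 : R) < 1 by rewrite lexx ltr01.
  apply: (@le_trans _ _ (Phi P kappa alpha S Z x' 0)).
    by apply: ereal_inf_lbound; exists 0.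
  have := spread_sqr x'I q'01; rewrite subr0 mulr1 => E.
  rewrite Phi_potential// lee_fin (potential_nincr _ _ alpha0)//; last first.
    by rewrite E mulVf// gt_eqF.
  rewrite -(@ler_pXn2r _ 2)// ?nnegrE ?sqrtr_ge0// -(lerD2l 1) E.
  by rewrite -[leRHS]mul1r ler_pdivlMr// ltW.
have conc x' := potential_concave alpha0 x' eq1.
have supE : sup_inf_Phi P kappa alpha S Z = (potential kappa lambda alpha x s)%:E.
  apply/eqP; rewrite eq_le; apply/andP; split.
    apply: ge_ereal_sup => _ [x' /= x'I <-]; rewrite (le_trans (inf_le _ x'I))// lee_fin.
    rewrite (le_trans (conc x'))// lerBlDr lerDl mulr_ge0 ?sqr_ge0// mulr_ge0//.
    by rewrite addr_ge0 ?sqr_ge0.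
  by apply: ereal_sup_ubound; exists x.
exists x, q; split.
- split; split.
  + by rewrite infE supE x0; split => //; lra.
  (* Another maximizer makes the quadratic loss in [potential_concave] nonpositive, so
     [(x' - x) ^ 2 = 0]. *)
  + move=> x' [x'01]; rewrite supE => E.
    have x'I : -1 < x' < 1 by lra.
    have := inf_le _ x'I; rewrite E lee_fin => h.
    have := le_trans h (conc x'); rewrite lerBrDl gerDr => h'.
    apply/eqP; rewrite eq_sym -subr_eq0 -sqrf_eq0 eq_le sqr_ge0 andbT.
    by move: h'; rewrite pmulr_rle0 ?mulr_gt0 ?ltr_pwDl ?sqr_ge0.
  + by split => //; rewrite Phi_potential// sq infE.
  + move=> q' [q'01]; rewrite Phi_potential// infE => -[E].
    apply/eqP; apply/negP => /negP; rewrite eq_sym => /(min_s _ q'01).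
    by rewrite E ltxx.
- rewrite unlock (expectation_margin (lin_quad lin_mills))//; last first.
    by move=> u; rewrite ltW// inv_mills_gt0.
  rewrite sq -EFinM; congr EFin.
  have sx0 : 0 < Num.sqrt (1 - x ^+ 2) by rewrite sqrtr_gt0.
  have m0 := sqrt1D_gt0 s.
  (* As [1 - q = 1 / p], the first equation only has to be divided by
     [msqrt s * sqrt (1 - x ^ 2)]. *)
  have -> : Num.sqrt (lambda * (1 - q)) = Num.sqrt lambda / (msqrt s * Num.sqrt (1 - x ^+ 2)).
    rewrite sqrtrM ?(ltW lambda0)// q1 sqrtrV ?(ltW p0)// /p sqrtrM//.
    by rewrite addr_ge0 ?sqr_ge0.
  rewrite -[gE _]/(mills_mean _ s) mulrA mulrAC -eq1.
  by field; rewrite !gt_eqF.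
- rewrite unlock (expectation_margin quad_sqr_mills)//; last by move=> u; exact: sqr_ge0.
  rewrite sq -EFinM; congr EFin.
  by rewrite -[gE _]/(mills_sqmean _ s) -eq2 q1 invrK /q mulrBl mul1r mulVf ?gt_eqF.
Qed.

End conclusion.

(** * Choice of the threshold on [alpha] *)

Unset Implicit Arguments.

Theorem proposition3p2 (R : realType) :
  exists alpha0 : R -> R -> R,
  forall kappa lambda : R, 0 < lambda ->
    0 < alpha0 lambda (Num.max kappa 0) /\
    forall alpha : R, 0 < alpha < alpha0 lambda (Num.max kappa 0) ->
    forall (d : measure_display) (T : measurableType d) (P : probability T R)
      (G Z : {RV P >-> R}),
    let S := fun w : T => Num.sqrt lambda + G w in
    std_gaussian G -> std_gaussian Z -> independent P S Z ->
    exists x q : R,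
      [/\ uniquely_achieved_at P kappa alpha S Z x q,
          (x / Num.sqrt (1 - x ^+ 2))%:E =
            ((alpha * Num.sqrt (lambda * (1 - q)))%:E *
             'E_P[fun w => inv_mills (normalized_margin kappa S Z x q w)])%E &
          (q / (1 - q))%:E =
            (alpha%:E *
             'E_P[fun w =>
                    (inv_mills (normalized_margin kappa S Z x q w)) ^+ 2]%R)%E].
Proof.
(* The two reciprocals yield [alpha_env1] and [alpha_env2]; the summand 1 keeps the first
   denominator positive when only [0 <= envelope1 k] is known. *)
exists (fun lambda k =>
  Num.min (2 * Num.sqrt lambda * envelope1 k + 1)^-1 (4 + 4 * envelope2 k)^-1).
move=> kappa lambda lambda0.
have k0 : 0 <= Num.max kappa 0 by rewrite le_max lexx orbT.
have C20 := envelope1_ge0 k0; have C10 := envelope2_ge0 (Num.max kappa 0).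
have a0 : 0 < 2 * Num.sqrt lambda * envelope1 (Num.max kappa 0) + 1.
  by rewrite ltr_wpDl// !mulr_ge0// sqrtr_ge0.
have b0 : 0 < 4 + 4 * envelope2 (Num.max kappa 0) by rewrite ltr_pwDl// mulr_ge0.
split; first by rewrite lt_min !invr_gt0 a0 b0.
move=> alpha /andP[alpha0]; rewrite lt_min => /andP[h1 h2] d T P G Z S sG sZ SZ.
apply: saddle_point_unique => //.
- move: h1; rewrite -[_^-1]mul1r ltr_pdivlMr// => h1.
  set t := Num.sqrt lambda in h1 *; set c := envelope1 _ in h1 *.
  by clear -h1 alpha0; lra.
- by move: h2; rewrite -[_^-1]mul1r ltr_pdivlMr.
Qed.
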